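(* Suppose that $\eta$ is locally bounded and denote by $\eta^*$ its upper semicontinuous envelope. If a distribution with distribution function $F$ can be embedded in $M$ before time $T>0$ (i.e. there is a stopping time $\tau\le T$ such that $M_\tau$ has distribution function $F$), then for all $x\in\mathbb{R}$ with $0<F(x)<1$ it must hold that $$\limsup_{\varepsilon\downarrow0}\;-\varepsilon^2\ln\bigl(F(x+\varepsilon)-F(x-\varepsilon)\bigr)\le\frac{\pi^2}{8}\,T\,\eta^*(x)^2 .$$
   Context: Setting. $\eta:\mathbb{R}\to[0,\infty)$ is Borel measurable, and the set of zeros of $\eta$ coincides with the set of points $x$ such that $1/\eta$ is not square integrable on any neighbourhood of $x$. Fix $m\in\mathbb{R}$ and put $l=\sup\{x\le m:\eta(x)=0\}$, $r=\inf\{x\ge m:\eta(x)=0\}$; assume $-\infty\le l<m<r\le\infty$. So $\eta>0$ on $(l,r)$, and by convention $\eta=0$ on $(-\infty,l)$ and $(r,\infty)$. $M$ is a weak solution (it exists and is unique in law) of $dM_s=\eta(M_s)\,dW_s$, $M_0=m$, with $W$ a Brownian motion on a filtered probability space satisfying the usual conditions; $M$ is absorbed at $l$ or $r$ if it reaches them. Convention: $\ln 0=-\infty$. *)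

(* Defs.v *)
From HB Require Import structures.
From mathcomp Require Import all_boot all_order all_algebra.
From mathcomp Require Import all_classical all_reals all_analysis.

Set Implicit Arguments.
Unset Strict Implicit.
Unset Printing Implicit Defensive.

Import Order.TTheory GRing.Theory Num.Theory.
Import numFieldNormedType.Exports.

Local Open Scope classical_set_scope.
Local Open Scope ring_scope.

Section processes.
Context (R : realType) (d : measure_display) (Omega : measurableType d).
Context (P : probability Omega R).

(* Time is [0, +oo[: filtrations and processes are indexed by R, but only their
   restrictions to nonnegative indices are constrained or used. *)
Context (Ft : R -> set (set Omega)).

Implicit Types W H X M : R -> Omega -> R.

Record usual_filtration : Prop := UsualFiltration {
  filtration_sigma_algebra : forall t : R, 0 <= t -> sigma_algebra setT (Ft t) ;
  filtration_measurable : forall t : R, 0 <= t -> Ft t `<=` measurable ;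
  filtration_nondecreasing : forall s t : R, 0 <= s -> s <= t -> Ft s `<=` Ft t ;
  filtration_right_continuous : forall t : R, 0 <= t ->
    \bigcap_(s in [set s | t < s]) Ft s `<=` Ft t ;
  filtration_complete : forall N : set Omega, P.-negligible N -> Ft 0 N }.

Definition measurable_wrt (G : set (set Omega)) (f : Omega -> R) : Prop :=
  forall B : set R, measurable B -> G (f @^-1` B).

Definition adapted X : Prop := forall t : R, 0 <= t -> measurable_wrt (Ft t) (X t).

Definition continuous_paths X : Prop :=
  forall w, {within `[0, +oo[, continuous (fun t => X t w)}.

(* For every t, (s, w) |-> H s w on [0, t] x Omega is measurable for the product
   of the Borel sigma-algebra and Ft t. *)
Definition progressively_measurable H : Prop :=
  forall t : R, 0 <= t -> forall B : set R, measurable B ->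
    <<s [set A `*` E | A in (measurable : set (set R)) & E in Ft t] >>
      [set z : R * Omega | 0 <= z.1 <= t /\ B (H z.1 z.2)].

Definition stopping_time (tau : Omega -> R) : Prop :=
  (forall w, 0 <= tau w) /\
  forall t : R, 0 <= t -> Ft t [set w | tau w <= t].

Record brownian_motion W : Prop := BrownianMotion {
  brownian_adapted : adapted W ;
  brownian_continuous : continuous_paths W ;
  brownian_start : {ae P, forall w, W 0 w = 0} ;
  (* the second parameter of normal_prob is the standard deviation *)
  brownian_increment_law : forall s t : R, 0 <= s -> s < t ->
    forall B : set R, measurable B ->
      P [set w | B (W t w - W s w)] = normal_prob 0 (Num.sqrt (t - s)) B ;
  brownian_increment_indep : forall s t : R, 0 <= s -> s < t ->
    forall (A : set Omega) (B : set R), Ft s A -> measurable B ->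
      P (A `&` [set w | B (W t w - W s w)]) =
      (P A * P [set w | B (W t w - W s w)%R])%E }.

(* The process \sum_(i < n) xi_i 1_{]t_i, t_(i+1)]}. *)
Record simple_process := SimpleProcess {
  simple_size : nat ;
  simple_time : nat -> R ;
  simple_coef : nat -> Omega -> R ;
  simple_time_ge0 : forall i, 0 <= simple_time i ;
  simple_time_nd : forall i, simple_time i <= simple_time i.+1 ;
  simple_coef_bounded : forall i, exists C, forall w, `|simple_coef i w| <= C ;
  simple_coef_measurable : forall i,
    measurable_wrt (Ft (simple_time i)) (simple_coef i) }.

Definition simple_eval (h : simple_process) : R -> Omega -> R := fun s w =>
  \sum_(i < simple_size h)
    simple_coef h i w * \1_(`]simple_time h i, simple_time h i.+1]) s.

Definition simple_integral W (h : simple_process) : R -> Omega -> R :=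
  fun t w => \sum_(i < simple_size h)
    simple_coef h i w * (W (Num.min (simple_time h i.+1) t) w
                       - W (Num.min (simple_time h i) t) w).

Definition cvg0_in_probability (Y : nat -> Omega -> \bar R) : Prop :=
  forall e : R, 0 < e -> P [set w | e%:E <= Y n w]%E @[n --> \oo] --> 0%E.

(* X is (a continuous version of) the Ito integral \int_0^. H dW: the integrand
   satisfies \int_0^t H^2 ds < +oo almost surely, and X is the limit, uniformly
   on compact time intervals in probability, of the integrals of simple
   processes that approximate H in probability in L^2([0, t]) for every t.
   This determines X up to indistinguishability. *)
Record is_ito_integral W H X : Prop := IsItoIntegral {
  ito_integrand_progressive : progressively_measurable H ;
  ito_integrand_L2loc : forall t : R, 0 <= t ->
    {ae P, forall w,
      (\int[lebesgue_measure]_(s in `[0%R, t]) ((H s w) ^+ 2)%:E < +oo)%E} ;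
  ito_adapted : adapted X ;
  ito_continuous : continuous_paths X ;
  ito_approximation : exists h : nat -> simple_process,
    forall t : R, 0 <= t ->
      cvg0_in_probability (fun n w =>
        \int[lebesgue_measure]_(s in `[0%R, t])
          ((simple_eval (h n) s w - H s w) ^+ 2)%:E)%E /\
      cvg0_in_probability (fun n w =>
        ereal_sup [set `|simple_integral W (h n) s w - X s w|%:E
                  | s in `[0, t]]%classic) }.

(* dM_s = eta(M_s) dW_s, M_0 = m; together with usual_filtration and
   brownian_motion, this makes (Omega, Ft, P, W, M) a weak solution. *)
Record sde_solution (eta : R -> R) (m : R) W M : Prop := SdeSolution {
  sde_adapted : adapted M ;
  sde_continuous : continuous_paths M ;
  sde_start : {ae P, forall w, M 0 w = m} ;
  sde_integral :
    is_ito_integral W (fun s w => eta (M s w)) (fun t w => M t w - m) }.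

Definition has_distribution_function (X : Omega -> R) (F : R -> R) : Prop :=
  forall x, P [set w | X w <= x] = (F x)%:E.

Definition embeddable_before M (T : R) (F : R -> R) : Prop :=
  exists tau : Omega -> R,
    [/\ stopping_time tau, forall w, tau w <= T &
        has_distribution_function (fun w => M (tau w) w) F].

Definition absorbed_at (a : \bar R) M : Prop :=
  {ae P, forall w, forall s t : R, 0 <= s -> s <= t ->
    (M s w)%:E = a -> (M t w)%:E = a}.

End processes.

Section coefficient.
Context (R : realType).
Implicit Types (eta : R -> R) (x m : R).

(* The inverse is taken in \bar R, so that 0^-1 = +oo. *)
Definition inv_square_integrable_near eta x : Prop :=
  exists U : set R, open_nbhs x U /\
    lebesgue_measure.-integrable U (fun y => (((eta y)%:E)^-1 ^+ 2)%E).

(* ereal_sup set0 = -oo and ereal_inf set0 = +oo *)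
Definition left_endpoint eta m : \bar R :=
  ereal_sup [set x%:E | x in [set x | x <= m /\ eta x = 0]].

Definition right_endpoint eta m : \bar R :=
  ereal_inf [set x%:E | x in [set x | m <= x /\ eta x = 0]].

Definition locally_bounded eta : Prop :=
  forall x, bounded_near eta (nbhs x).

(* limsup over y -> x, with y = x allowed *)
Definition usc_envelope eta x : \bar R := limf_esup (EFin \o eta) (nbhs x).

Definition upper_semicontinuous (f : R -> \bar R) : Prop :=
  lower_semicontinuous (fun x => - f x)%E.

Lemma le_usc_envelope eta x : ((eta x)%:E <= usc_envelope eta x)%E.
Proof.
apply: le_ereal_inf_tmp => _ [V Vx <-]; apply: ereal_sup_ubound.
by exists x => //; exact: nbhs_singleton.
Qed.

Lemma usc_envelope_usc eta : upper_semicontinuous (usc_envelope eta).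
Proof.
move=> x a; rewrite lteNr => /ereal_inf_lt[_ [V Vx <-] supVa].
have [U [oU Ux] UV] : exists2 U, open_nbhs x U & U `<=` V.
  by move: Vx; rewrite nbhsE.
exists U; first exact: open_nbhs_nbhs.
move=> y Uy; rewrite lteNr; apply: le_lt_trans supVa.
apply: ereal_inf_lbound; exists V => //.
by apply: filterS UV _; exact: open_nbhs_nbhs.
Qed.

Lemma usc_envelope_le eta (g : R -> \bar R) : upper_semicontinuous g ->
  (forall x, ((eta x)%:E <= g x)%E) -> forall x, (usc_envelope eta x <= g x)%E.
Proof.
move=> uscg eta_g x; have := eta_g x; case gx : (g x) => [r| |] // _.
  apply/lee_addgt0Pr => e e0.
  have [|V Vx gV] := uscg x (- (r + e)).
    by rewrite gx EFinN lteN2 lte_fin ltrDl.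
  apply: (@le_trans _ _ (ereal_sup ((EFin \o eta) @` V))).
    by apply: ereal_inf_lbound; exists V.
  apply: ge_ereal_sup => _ [y Vy <-]; apply: (le_trans (eta_g y)).
  by have := gV y Vy; rewrite EFinN lteN2 => /ltW.
by rewrite leey.
Qed.

End coefficient.

(* Main.v *)
(* Let theta = pi / (2 e1) be such that
   cos (theta (y - x)) vanishes at y = x +- e1. Multiplying cos (theta (M - x)) by
   exp (theta^2 <M> / 2) yields a martingale up to the exit from the window, so that from
   a position near x the martingale stays within e1 of x until time T with probability at
   least a constant times exp (- theta^2 L / 2) as soon as eta^2 T <= L on the window.
   Since 0 < F x < 1, M visits x before tau with some probability 2 p > 0 that does not
   depend on the window, and after the first visit M may stay near x until tau, so
   P (|M_tau - x| <= e) >= c p exp (- pi^2 L / (8 e^2)) for e1 close to e and L close to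
   T eta^*(x)^2.

   The Ito integral is only accessible through simple processes, so the
   argument runs along the discrete sums \sum xi_k (W v_(k+1) - W v_k), frozen before their
   quadratic variation exceeds L; there the martingale is replaced by a submartingale, a
   factor rho > 1 in its exponent absorbing the discretisation error. *)

Require Import Defs.
From HB Require Import structures.
From mathcomp Require Import all_boot all_order all_algebra.
From mathcomp Require Import all_classical all_reals all_analysis.
From mathcomp Require Import measurable_realfun.
From mathcomp Require Import ring lra.

Set Implicit Arguments.
Unset Strict Implicit.
Unset Printing Implicit Defensive.

Import Order.TTheory GRing.Theory Num.Theory.
Import numFieldNormedType.Exports.

Local Open Scope classical_set_scope.
Local Open Scope ring_scope.

(** Only the exponent has to be sharp; constant prefactors disappear after multiplication by [e^2].
    A simple process close to [eta (M)] is close only in L^2 in time and only outside an event of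
    small probability, so it inherits no useful pointwise bound from [eta <= K] near [x]. The cap
    [L] on the clock bounds the exponential factor on all of [Omega], and on a good path the cap is
    not felt before [M] leaves the larger window [e2]. A walk on a grid leaves the window by a jump.
    The cosine is nonpositive only up to distance [3 * e1], so the grid must be finer than a modulus
    of continuity of [M] valid outside a small event. Neither the grid nor the simple process
    appears in the resulting bound, so the probability of the exceptional events can tend to 0 with
    the window fixed. The first visit to [x] is replaced by the first dyadic time, not after [tau],
    at which [M] is within [e1 / 2] of [x]; this costs the factor [cos (pi / 4)] and leaves a finite
    union of deterministic times in place of a hitting time. *)

(** * Elementary inequalities for sine, cosine and exponential *)

Lemma is_derive_nondecreasing (R : realType) (f df : R -> R) :
  (forall x : R, is_derive x 1 f (df x)) -> (forall x : R, 0 <= x -> 0 <= df x) ->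
  forall x : R, 0 <= x -> f 0 <= f x.
Proof.
move=> fdf df0 x x0; rewrite -subr_ge0.
have [|c c0x ->] := MVT_segment x0 (fun y _ => fdf y).
  by apply: derivable_within_continuous => y _; case: (fdf y).
by rewrite mulr_ge0 ?df0 ?subr_ge0//; move: c0x; rewrite in_itv => /andP[].
Qed.

Lemma sin_le_id (R : realType) (x : R) : 0 <= x -> sin x <= x.
Proof.
move=> x0; rewrite -subr_ge0.
have d1 (y : R) : is_derive y 1 (id - sin) (1 - cos y) by exact: is_deriveB.
have d2 (y : R) : 0 <= y -> 0 <= 1 - cos y by rewrite subr_ge0 cos_le1.
by have := is_derive_nondecreasing d1 d2 x0; rewrite !fctE sin0 subrr.
Qed.

Lemma sin_ge_opp_id (R : realType) (x : R) : 0 <= x -> - x <= sin x.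
Proof.
move=> x0; rewrite -subr_ge0 opprK.
have d1 (y : R) : is_derive y 1 (sin + id) (cos y + 1) by exact: is_deriveD.
have d2 (y : R) : 0 <= y -> 0 <= cos y + 1 by rewrite -lerBlDr sub0r cos_geN1.
by have := is_derive_nondecreasing d1 d2 x0; rewrite !fctE sin0 addr0.
Qed.

Lemma id_le_sinh (R : realType) (x : R) : 0 <= x -> x <= (expR x - expR (- x)) / 2.
Proof.
move=> x0.
suff : 0 <= expR x - expR (- x) - 2 * x by lra.
have d1 (y : R) : is_derive y 1 (expR - (expR \o -%R) - *%R 2)
    (expR y - expR (- y) * - 1 - 2).
  have d0 : is_derive y 1 (expR \o -%R : R -> R) (expR (- y) * - 1).
    exact: is_derive1_comp.
  have d2 : is_derive y 1 ( *%R 2 : R -> R) 2.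
    by apply: is_derive_eq; rewrite /GRing.scale/= mulr1.
  exact: is_deriveB.
have d2 (y : R) : 0 <= y -> 0 <= expR y - expR (- y) * - 1 - 2.
  move=> _.
  have e0 := expR_gt0 y; have : expR y * expR (- y) = 1 by rewrite -expRD subrr expR0.
  have := sqr_ge0 (expR y - expR (- y)).
  have := expR_gt0 (- y).
  nra.
have := is_derive_nondecreasing d1 d2 x0.
by rewrite !fctE/= oppr0 expR0 mulr0 subrr subr0.
Qed.

(** With [x = 2 y] one has [cos x = 1 - 2 sin^2 y] and [cosh x = 1 + 2 sinh^2 y], so the claim is
    [sin^2 y <= y^2 <= sinh^2 y]. It reduces Gaussian integrals of the cosine to those of real
    exponentials. *)
Lemma cosDcosh_ge2 (R : realType) (x : R) : 2 <= cos x + (expR x + expR (- x)) / 2.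
Proof.
wlog x0 : x / 0 <= x.
  move=> W; have [/W//|/ltW x0] := leP 0 x.
  by have := W (- x); rewrite oppr_ge0 cosN opprK [_ + expR x]addrC; apply.
set y := x / 2; have y0 : 0 <= y by rewrite divr_ge0.
have -> : x = y *+ 2 by rewrite /y; lra.
rewrite cos_mulr2n cos2sin2 -mulNrn (mulr2n y) (mulr2n (- y)) !expRD.
have h1 := id_le_sinh y0; have h2 := sin_le_id y0.
have h3 := sin_ge_opp_id y0.
have : expR y * expR (- y) = 1 by rewrite -expRD subrr expR0.
have : sin y ^+ 2 <= y ^+ 2 by rewrite -subr_ge0 subr_sqr mulr_ge0//; lra.
have : y ^+ 2 <= ((expR y - expR (- y)) / 2) ^+ 2 by rewrite lerXn2r ?nnegrE//; lra.
rewrite !expr2; lra.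
Qed.

(** To first order the sides are [1 - rho u] and [1 - u], so any [rho > 1] suffices for small [u].
    Bounding the exponentials by [1 / (1 + rho u)] and [1 / (1 - u)] leaves
    [0 <= u (rho - 1 - 2 rho u)], which is the smallness hypothesis. *)
Lemma expRN_le_2BexpR (R : realType) (rho u : R) : 1 < rho -> 0 <= u -> 2 * rho * u <= rho - 1 ->
  expR (- (rho * u)) <= 2 - expR u.
Proof.
move=> r1 u0 ur.
have u1 : u < 1 by nra.
have h1 : expR u <= (1 - u)^-1.
  rewrite -[expR u]invrK lef_pV2 ?posrE ?invr_gt0 ?expR_gt0 ?subr_gt0//.
  by rewrite -expRN expR_ge1Dx.
have h2 : expR (- (rho * u)) <= (1 + rho * u)^-1.
  rewrite expRN lef_pV2 ?posrE ?expR_gt0 ?expR_ge1Dx//.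
  by rewrite ltr_wpDr// mulr_ge0//; lra.
apply: (le_trans h2); apply: (@le_trans _ _ (2 - (1 - u)^-1)); last by lra.
have -> : 2 - (1 - u)^-1 = (1 - 2 * u) / (1 - u) by field; lra.
have ru : 0 <= rho * u by apply: mulr_ge0 => //; lra.
rewrite ler_pdivlMr; last lra.
rewrite mulrC ler_pdivrMr; last lra.
nra.
Qed.

(** * Gaussian integrals of exponentials and trigonometric functions *)

Section normal.
Context {R : realType}.
Notation mu := (@lebesgue_measure R).

Lemma ge0_integral_normal_prob (m s : R) (f : R -> \bar R) :
  (forall x, 0 <= f x)%E -> measurable_fun [set: R] f ->
  (\int[normal_prob m s]_x f x = \int[mu]_x (f x * (normal_pdf m s x)%:E))%E.
Proof.
move=> f0 mf; have nmu := normal_prob_dominates m s.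
pose g := Radon_Nikodym_SigmaFinite.f (normal_prob m s) mu.
have gi : mu.-integrable setT g := Radon_Nikodym_SigmaFinite.f_integrable nmu.
rewrite -(Radon_Nikodym_SigmaFinite.change_of_variables nmu)//.
apply: ae_eq_integral => //.
- by apply: emeasurable_funM => //; exact: measurable_int gi.
- by apply: emeasurable_funM => //; apply/measurable_EFinP; exact: measurable_normal_pdf.
- apply: ae_eqe_mul2l => /=; apply: integral_ae_eq => //=.
  + by apply/measurable_EFinP; exact: measurable_normal_pdf.
  + by move=> E _ mE; rewrite -(Radon_Nikodym_SigmaFinite.f_integral nmu).
Qed.

(** Completing the square turns the integrand into a constant times the Gaussian density centred at
    [b * s ^+ 2]. *)
Lemma integral_expR_normal_prob (s b : R) : s != 0 ->
  (\int[normal_prob 0 s]_z (expR (b * z))%:E = (expR (b ^+ 2 * s ^+ 2 / 2))%:E)%E.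
Proof.
move=> s0; rewrite ge0_integral_normal_prob; last 2 first.
- by move=> x; rewrite lee_fin expR_ge0.
- apply/measurable_EFinP; apply: measurableT_comp => //.
transitivity (\int[mu]_z ((expR (b ^+ 2 * s ^+ 2 / 2))%:E * (normal_pdf (b * s ^+ 2) s z)%:E))%E.
  apply: eq_integral => z _; rewrite -!EFinM /normal_pdf (negbTE s0).
  rewrite 2!mulrA ![_ * normal_peak _]mulrC -!mulrA; congr (_ * _)%:E.
  by rewrite /normal_fun -!expRD; congr expR; field.
rewrite integralZl//; last exact: integrable_normal_pdf.
by rewrite integral_normal_pdf mule1.
Qed.

Lemma integral_oppr_normal_prob (s : R) (f : R -> \bar R) : s != 0 ->
  (forall x, 0 <= f x)%E -> measurable_fun [set: R] f ->
  (\int[normal_prob 0 s]_z f (- z)%R = \int[normal_prob 0 s]_z f z)%E.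
Proof.
move=> s0 f0 mf; rewrite !ge0_integral_normal_prob//; last first.
  by apply: measurableT_comp.
transitivity (\int[mu]_(z in (-%R : R -> measurableTypeR R) @^-1` setT) (((fun z => f z * (normal_pdf 0 s z)%:E) \o -%R) z))%E.
  rewrite preimage_setT; apply: eq_integral => z _ /=; congr (_ * _%:E)%E.
  by rewrite /normal_pdf (negbTE s0) /normal_fun !subr0 sqrrN.
rewrite -ge0_integral_pushforward//=.
- by apply: eq_measure_integral => //= A mA _; exact: lebesgue_measureN.
- by apply: emeasurable_funM => //; apply/measurable_EFinP; exact: measurable_normal_pdf.
- by move=> z _; rewrite mule_ge0// lee_fin normal_pdf_ge0.
Qed.
End normal.

Lemma integrable_le_cst d (T : measurableType d) (R : realType)
    (mu : {finite_measure set T -> \bar R}) (f : T -> R) (C : R) :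
  measurable_fun setT f -> (forall x, `|f x| <= C) -> mu.-integrable setT (EFin \o f).
Proof.
move=> mf fC; apply: measurable_bounded_integrable => //.
  by rewrite -ge0_fin_numE ?fin_num_measure.
by exists C; split=> [|y Cy x _]; [exact: num_real|exact: le_trans (fC x) (ltW Cy)].
Qed.

Lemma measurable_sin (R : realType) : measurable_fun [set: R] (@sin R).
Proof. by apply: continuous_measurable_fun; exact: continuous_sin. Qed.

Lemma measurable_cos (R : realType) : measurable_fun [set: R] (@cos R).
Proof. by apply: continuous_measurable_fun; exact: continuous_cos. Qed.

Section normal_cos.
Context {R : realType}.

Lemma integrable_expR_normal_prob (s b : R) : s != 0 ->
  (normal_prob 0 s).-integrable [set: R] (EFin \o (fun z => expR (b * z))).
Proof.
move=> s0; apply/integrableP; split.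
  by apply/measurable_EFinP; apply: measurableT_comp => //.
under eq_integral do rewrite /= ger0_norm ?expR_ge0//.
by rewrite integral_expR_normal_prob ?ltry.
Qed.

Lemma Rintegral_sin_normal_prob (s b : R) : s != 0 ->
  \int[normal_prob 0 s]_z sin (b * z) = 0.
Proof.
move=> s0.
have msin : measurable_fun [set: R] (fun z => sin (b * z)).
  by apply: measurableT_comp; first exact: measurable_sin.
have isin : (normal_prob 0 s).-integrable [set: R] (EFin \o (fun z => sin (b * z))).
  by apply: (@integrable_le_cst _ _ _ _ _ 1) => // z; rewrite sin_max.
have i1 : (normal_prob 0 s).-integrable [set: R] (EFin \o (fun z => 1)).
  by apply: (@integrable_le_cst _ _ _ _ _ 1) => // z; rewrite normr1.
(* The reflection [z -> - z] is applied to a nonnegative function, hence the shift by 1. *)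
have : \int[normal_prob 0 s]_z (1 - sin (b * z)) = \int[normal_prob 0 s]_z (1 + sin (b * z)).
  rewrite /Rintegral; congr fine.
  rewrite -[RHS](@integral_oppr_normal_prob _ _ (fun z => (1 + sin (b * z))%:E))//.
    by apply: eq_integral => z _; rewrite mulrN sinN.
  by apply/measurable_EFinP/measurable_funD.
rewrite RintegralB// RintegralD//; lra.
Qed.

Lemma Rintegral_cos_normal_prob_ge (s b : R) : s != 0 ->
  2 - expR (b ^+ 2 * s ^+ 2 / 2) <= \int[normal_prob 0 s]_z cos (b * z).
Proof.
move=> s0.
have mcos : measurable_fun [set: R] (fun z => cos (b * z)).
  by apply: measurableT_comp; first exact: measurable_cos.
have icos : (normal_prob 0 s).-integrable [set: R] (EFin \o (fun z => cos (b * z))).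
  by apply: (@integrable_le_cst _ _ _ _ _ 1) => // z; rewrite cos_max.
have e1 := integrable_expR_normal_prob b s0.
have e2 := integrable_expR_normal_prob (- b) s0.
have i1 : (normal_prob 0 s).-integrable [set: R] (EFin \o (fun z => 2)).
  by apply: (@integrable_le_cst _ _ _ _ _ 2) => // z; rewrite ger0_norm.
have iD : (normal_prob 0 s).-integrable [set: R]
    (EFin \o (fun z => expR (b * z) + expR (- b * z))).
  by have := integrableD measurableT e1 e2; apply.
have iZ : (normal_prob 0 s).-integrable [set: R]
    (EFin \o (fun z => (expR (b * z) + expR (- b * z)) / 2)).
  have := integrableZr measurableT 2^-1 iD; apply: eq_integrable => // z _.
have iB : (normal_prob 0 s).-integrable [set: R]
    (EFin \o (fun z => 2 - (expR (b * z) + expR (- b * z)) / 2)).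
  by have := integrableB measurableT i1 iZ; apply.
have -> : 2 - expR (b ^+ 2 * s ^+ 2 / 2) =
    \int[normal_prob 0 s]_z (2 - (expR (b * z) + expR (- b * z)) / 2).
  rewrite RintegralB// RintegralZr// RintegralD// Rintegral_cst//.
  rewrite /Rintegral !integral_expR_normal_prob//= probability_setT sqrrN /=; lra.
apply: le_Rintegral => // z _; have := cosDcosh_ge2 (b * z); rewrite -mulNr; lra.
Qed.

(** The sine term of the addition formula integrates to 0 by symmetry, and [0 <= cos y] preserves
    the lower bound for the remaining cosine integral. *)
Lemma Rintegral_cosD_normal_prob_ge (s b y : R) : s != 0 -> 0 <= cos y ->
  cos y * (2 - expR (b ^+ 2 * s ^+ 2 / 2)) <= \int[normal_prob 0 s]_z cos (y + b * z).
Proof.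
move=> s0 cy0.
have mcos : measurable_fun [set: R] (fun z => cos (b * z)).
  by apply: measurableT_comp; first exact: measurable_cos.
have icos : (normal_prob 0 s).-integrable [set: R] (EFin \o (fun z => cos (b * z))).
  by apply: (@integrable_le_cst _ _ _ _ _ 1) => // z; rewrite cos_max.
have msin : measurable_fun [set: R] (fun z => sin (b * z)).
  by apply: measurableT_comp; first exact: measurable_sin.
have isin : (normal_prob 0 s).-integrable [set: R] (EFin \o (fun z => sin (b * z))).
  by apply: (@integrable_le_cst _ _ _ _ _ 1) => // z; rewrite sin_max.
under eq_Rintegral do rewrite cosD.
rewrite RintegralB//; last 2 first.
- have := integrableZl measurableT (cos y) icos; apply: eq_integrable => // z _.
- have := integrableZl measurableT (sin y) isin; apply: eq_integrable => // z _.
rewrite !RintegralZl// Rintegral_sin_normal_prob// mulr0 subr0.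
by rewrite ler_wpM2l// Rintegral_cos_normal_prob_ge.
Qed.
End normal_cos.

(** * Integrating out an independent variable *)

Section probability_Rintegral.
Context d (T : measurableType d) (R : realType) (P : probability T R).

Lemma Rintegral_probability_cst (r : R) : \int[P]_(_ in setT) r = r.
Proof.
have P1 : P setT = 1%E by exact: probability_setT.
by rewrite Rintegral_cst//; move: P1 => /= ->; rewrite mulr1.
Qed.

Lemma normr_Rintegral_le (f : T -> R) (C : R) :
  measurable_fun setT f -> (forall x, `|f x| <= C) -> `|\int[P]_x f x| <= C.
Proof.
move=> mf fC; have fi := integrable_le_cst P mf fC.
rewrite (le_trans (le_normr_Rintegral measurableT fi))//.
rewrite -[leRHS]Rintegral_probability_cst; apply: le_Rintegral => //.
  apply: (@integrable_le_cst _ _ _ _ _ C) => [|x]; last by rewrite normr_id.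
  exact: measurableT_comp.
by apply: (@integrable_le_cst _ _ _ _ _ `|C|) => // x.
Qed.
End probability_Rintegral.

Section freezing.
Context d (T : measurableType d) (R : realType) (P : probability T R).
Context (G : set (set T)) (sG : sigma_algebra setT G) (mG : G `<=` measurable).
Context d' (T' : measurableType d') (D : T -> T') (mD : measurable_fun setT D).
Context (N : probability T' R).
Hypothesis DN : forall A B, G A -> measurable B ->
  P (A `&` D @^-1` B) = (P A * N B)%E.

(** This takes the place of conditioning on [G]. By [DN] the law of [(w, D w)] on the product of [G]
    with [T'] agrees on rectangles with the product of the restriction of [P] to [G] and [N], hence
    everywhere, and Fubini applies. *)
Lemma Rintegral_freezing (Phi : g_sigma_algebraType G * T' -> R) (C : R) :
  measurable_fun setT Phi -> (forall z, `|Phi z| <= C) ->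
  P.-integrable setT (EFin \o (fun w => \int[N]_z Phi (w, z))) /\
  \int[P]_w Phi (w, D w) = \int[P]_w \int[N]_z Phi (w, z).
Proof.
move=> mPhi PhiC.
have mid : measurable_fun [set: T] (id : T -> g_sigma_algebraType G).
  move=> _ A mA; rewrite setTI preimage_id; apply: mG.
  by move: mA; rewrite measurable_g_measurableTypeE.
have mpair : measurable_fun [set: T] (fun w => (w, D w) : g_sigma_algebraType G * T').
  by apply: measurable_fun_pair.
pose idG : {mfun T >-> g_sigma_algebraType G} :=
  HB.pack (id : T -> g_sigma_algebraType G) (isMeasurableFun.Build _ _ _ _ _ mid).
pose pairG : {mfun T >-> (g_sigma_algebraType G * T')%type} :=
  HB.pack (fun w : T => (w, D w) : g_sigma_algebraType G * T')
    (isMeasurableFun.Build _ _ _ _ _ mpair).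
pose Q := (distribution P idG \x N)%E.
have QE X : measurable X -> Q X = distribution P pairG X.
  apply: product_measure_unique => A B mA mB /=.
  rewrite /distribution/= /pushforward/=.
  have GA : G A by move: mA; rewrite measurable_g_measurableTypeE.
  rewrite -DN//; congr (P _).
have iPhi (mu : probability (g_sigma_algebraType G * T')%type R) :
    mu.-integrable setT (EFin \o Phi).
  exact: integrable_le_cst PhiC.
have mF := measurable_fubini_F (iPhi _ : Q.-integrable setT (EFin \o Phi)).
have PhiN w : N.-integrable setT (EFin \o (fun z => Phi (w, z))).
  apply: (@integrable_le_cst _ _ _ _ _ C) => //.
  exact: (measurableT_comp mPhi (measurable_pair1 _)).
have FE w : fubini_F N (EFin \o Phi) w = (\int[N]_z Phi (w, z))%:E.
  by rewrite /fubini_F /Rintegral fineK//; have := integrable_fin_num measurableT (PhiN w).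
have FC w : `|\int[N]_z Phi (w, z)| <= C.
  apply: normr_Rintegral_le => //.
  exact: (measurableT_comp mPhi (measurable_pair1 _)).
have mF' : measurable_fun setT (fun w : g_sigma_algebraType G => \int[N]_z Phi (w, z)).
  by apply/measurable_EFinP; apply: eq_measurable_fun mF => w _; exact: FE.
have iF : P.-integrable setT (EFin \o (fun w => \int[N]_z Phi (w, z))).
  by apply: (@integrable_le_cst _ _ _ _ _ C) => //; exact: (measurableT_comp mF' mid).
split=> //; rewrite /Rintegral; congr fine.
transitivity (\int[distribution P pairG]_z (Phi z)%:E)%E.
  rewrite integral_distribution//.
    exact/measurable_EFinP.
  apply: (@integrable_le_cst _ _ _ _ (fun w => Phi (w, D w)) C) => //.
  exact: (measurableT_comp mPhi mpair).
rewrite (eq_measure_integral Q); last by move=> A mA _; exact/esym/QE.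
rewrite -integral12_prod_meas1; last exact: iPhi.
transitivity (\int[distribution P idG]_w (\int[N]_z Phi (w, z))%:E)%E.
  by apply: eq_integral => w _; exact: FE.
by rewrite integral_distribution//; exact/measurable_EFinP.
Qed.
End freezing.

(** * One Brownian increment *)

(** Equivalent to [measurable_wrt (Ft t)], but phrased through [measurable_fun], so that sums,
    products and compositions are covered by its closure properties. *)
Definition Ft_measurable (R : realType) (Omega : pointedType) (Ft : R -> set (set Omega)) (t : R)
    (f : Omega -> R) :=
  measurable_fun setT (f : g_sigma_algebraType (Ft t) -> R).

Section brownian_step.
Context (R : realType) (d : measure_display) (Omega : measurableType d).
Context (P : probability Omega R) (Ft : R -> set (set Omega)).
Hypothesis usual : usual_filtration P Ft.

Lemma Ft_measurable_wrt t f : 0 <= t ->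
  measurable_wrt (Ft t) f <-> Ft_measurable Ft t f.
Proof.
move=> t0; have sF := filtration_sigma_algebra usual t0.
split=> [mf _ B mB|mf B mB].
  by rewrite setTI measurable_g_measurableTypeE//; exact: mf.
by rewrite -(measurable_g_measurableTypeE sF) -[X in measurable X]setTI; exact: mf.
Qed.

Lemma Ft_measurable_le s t f : 0 <= s -> s <= t ->
  Ft_measurable Ft s f -> Ft_measurable Ft t f.
Proof.
move=> s0 st /(Ft_measurable_wrt _ s0) mf; have t0 := le_trans s0 st.
apply/(Ft_measurable_wrt _ t0) => B mB.
by apply: (filtration_nondecreasing usual s0 st); exact: mf.
Qed.

Lemma Ft_measurable_measurable t f : 0 <= t ->
  Ft_measurable Ft t f -> measurable_fun setT f.
Proof.
move=> t0 /(Ft_measurable_wrt _ t0) mf _ B mB; rewrite setTI.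
by apply: (filtration_measurable usual t0); exact: mf.
Qed.

Context (W : R -> Omega -> R) (BM : brownian_motion P Ft W).

(* Gaussian integrals are only bounded below here, through [cos >= 2 - cosh]; the price is
   the factor [rho] and the smallness condition on the step. *)
Lemma brownian_cos_step (s t rho C : R) (U y g : Omega -> R) : 0 <= s -> s <= t ->
  1 < rho -> Ft_measurable Ft s U -> Ft_measurable Ft s y -> Ft_measurable Ft s g ->
  (forall w, 0 <= U w <= C) ->
  (forall w, g w = 0 \/ 0 <= cos (y w) /\ rho * (g w ^+ 2 * (t - s)) <= rho - 1) ->
  \int[P]_w (U w * (cos (y w) * expR (- (rho * (g w ^+ 2 * (t - s) / 2))))) <=
  \int[P]_w (U w * cos (y w + g w * (W t w - W s w))).
Proof.
(* Equal times are treated apart, since the increment has a nondegenerate Gaussian law only for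
   [s < t]. Grids constant from some index on make this case occur. *)
move=> s0; rewrite le_eqVlt => /predU1P[<-|st] rho1 mU my mg UC gy.
  rewrite subrr (@eq_Rintegral _ _ _ _ _ (fun w => U w * cos (y w + g w * (W s w - W s w))))//.
  by move=> w _; rewrite subrr !mulr0 mul0r mulr0 oppr0 expR0 mulr1 addr0.
have t0 := le_trans s0 (ltW st).
have ts0 : 0 <= t - s by rewrite subr_ge0 ltW.
have sg0 : Num.sqrt (t - s) != 0 by rewrite gt_eqF// sqrtr_gt0 subr_gt0.
have sFs := filtration_sigma_algebra usual s0.
have mFs := filtration_measurable usual s0.
have mW u : 0 <= u -> measurable_fun setT (W u).
  by move=> u0; apply/(Ft_measurable_measurable u0)/(Ft_measurable_wrt _ u0)/(brownian_adapted BM).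
have mD : measurable_fun setT (fun w => W t w - W s w : measurableTypeR R).
  by apply: measurable_funB; exact: mW.
have DN A B : Ft s A -> measurable B ->
    P (A `&` (fun w => W t w - W s w) @^-1` B) =
    (P A * normal_prob 0 (Num.sqrt (t - s)) B)%E.
  move=> FA mB; rewrite (brownian_increment_indep BM s0 st FA mB).
  by rewrite (brownian_increment_law BM s0 st mB).
pose Phi (z : g_sigma_algebraType (Ft s) * measurableTypeR R) := U z.1 * cos (y z.1 + g z.1 * z.2).
have mPhi : measurable_fun setT Phi.
  apply: measurable_funM.
    exact: (measurableT_comp mU measurable_fst).
  apply: measurableT_comp; first exact: measurable_cos.
  apply: measurable_funD; first exact: (measurableT_comp my measurable_fst).
  apply: measurable_funM; last exact: measurable_snd.
  exact: (measurableT_comp mg measurable_fst).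
have PhiC z : `|Phi z| <= C.
  rewrite normrM; have /andP[U0 U1] := UC z.1.
  rewrite (le_trans _ U1)// (ger0_norm U0) -[leRHS]mulr1 ler_wpM2l//; exact: cos_max.
have [iF E] := Rintegral_freezing (N := normal_prob 0 (Num.sqrt (t - s))) sFs mFs mD DN mPhi PhiC.
rewrite [leRHS]E; apply: le_Rintegral => //.
  apply: (@integrable_le_cst _ _ _ _ _ C).
    apply: (Ft_measurable_measurable s0); apply: measurable_funM => //.
    apply: measurable_funM; first by apply: measurableT_comp => //; exact: measurable_cos.
    apply: measurableT_comp => //; apply: measurable_funN; apply: measurable_funM => //.
    by apply: measurable_funM => //; apply: measurable_funM => //; exact: measurable_funX.
  move=> w; rewrite normrM; have /andP[U0 U1] := UC w.
  rewrite (le_trans _ U1)// (ger0_norm U0) -[leRHS]mulr1 ler_wpM2l// normrM.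
  rewrite mulr_ile1//; first exact: cos_max.
  rewrite ger0_norm ?expR_ge0// expR_le1 oppr_le0.
  apply: mulr_ge0; first lra.
  by rewrite divr_ge0// mulr_ge0// sqr_ge0.
move=> w _; have /andP[U0 U1] := UC w.
rewrite /Phi/= RintegralZl//; last first.
  apply: (@integrable_le_cst _ _ _ _ _ 1).
    apply: measurableT_comp; first exact: measurable_cos.
    by apply: measurable_funD => //; exact: measurable_funM.
  by move=> z; rewrite cos_max.
rewrite ler_wpM2l//; case: (gy w) => [->|[cy gs]].
  under eq_Rintegral do rewrite mul0r addr0.
  by rewrite Rintegral_probability_cst expr0n/= !mul0r mulr0 oppr0 expR0 mulr1.
apply: le_trans (Rintegral_cosD_normal_prob_ge _ sg0 cy); rewrite ler_wpM2l//.
rewrite sqr_sqrtr ?subr_ge0 ?(ltW st)//.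
apply: expRN_le_2BexpR => //; last lra.
by rewrite divr_ge0// mulr_ge0// sqr_ge0.
Qed.
End brownian_step.

(** * The gated walk and its exponential submartingale *)

Section stopped_exponential.
Context (R : realType) (d : measure_display) (Omega : measurableType d).
Context (P : probability Omega R) (Ft : R -> set (set Omega)).
Hypothesis usual : usual_filtration P Ft.
Context (W : R -> Omega -> R) (BM : brownian_motion P Ft W).
Context (v : nat -> R) (v0 : 0 <= v 0%N) (v_nd : forall k, v k <= v k.+1).
Context (xi : nat -> Omega -> R) (mxi : forall k, Ft_measurable Ft (v k) (xi k)).
Context (Y0 : Omega -> R) (mY0 : Ft_measurable Ft (v 0%N) Y0).
Context (x e L : R).

(* In a state [(position, clock)], the increment is switched off from the first exit of the
   position from the window on, and when the clock would run past [L]. *)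
Definition gate (st : R * R) (h dt : R) : R :=
  if (`|st.1 - x| < e) && (st.2 + h ^+ 2 * dt <= L) then h else 0.

Fixpoint gated (k : nat) (w : Omega) : R * R :=
  if k is j.+1 then
    let st := gated j w in
    let g := gate st (xi j w) (v j.+1 - v j) in
    (st.1 + g * (W (v j.+1) w - W (v j) w), st.2 + g ^+ 2 * (v j.+1 - v j))
  else (Y0 w, 0).

Let v_ge0 k : 0 <= v k.
Proof. by elim: k => // k IH; exact: le_trans IH (v_nd k). Qed.

Let mW k : Ft_measurable Ft (v k) (W (v k)).
Proof. exact/(Ft_measurable_wrt usual _ (v_ge0 k))/(brownian_adapted BM). Qed.

Lemma gated_measurable k :
  [/\ Ft_measurable Ft (v k) (fun w => (gated k w).1),
      Ft_measurable Ft (v k) (fun w => (gated k w).2) &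
      Ft_measurable Ft (v k) (fun w => gate (gated k w) (xi k w) (v k.+1 - v k))].
Proof.
have mg j : Ft_measurable Ft (v j) (fun w => (gated j w).1) ->
    Ft_measurable Ft (v j) (fun w => (gated j w).2) ->
    Ft_measurable Ft (v j) (fun w => gate (gated j w) (xi j w) (v j.+1 - v j)).
  move=> m1 m2; apply: measurable_fun_ifT => //.
  - apply: measurable_and.
      apply: measurable_fun_ltr => //.
      apply: measurableT_comp => //.
      by apply: measurable_funB.
    apply: measurable_fun_ler => //.
    apply: measurable_funD => //; apply: measurable_funM => //.
    by apply: measurable_funX; exact: mxi.
  - exact: mxi.
suff [m1 m2] : Ft_measurable Ft (v k) (fun w => (gated k w).1) /\
    Ft_measurable Ft (v k) (fun w => (gated k w).2).
  by split=> //; exact: mg.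
elim: k => [|k [IH1 IH2]]; first by split=> //; exact: measurable_cst.
have le f := @Ft_measurable_le _ _ _ _ _ usual (v k) (v k.+1) f (v_ge0 k) (v_nd k).
split; apply: measurable_funD; try exact: le.
  apply: measurable_funM; first by apply: (le _ (mg k IH1 IH2)).
  by apply: measurable_funB; [exact: mW|exact: le].
by apply: measurable_funM => //; apply: measurable_funX; apply: (le _ (mg k IH1 IH2)).
Qed.

Lemma gated_bound k w : 0 <= L -> 0 <= (gated k w).2 <= L.
Proof.
move=> L0; elim: k => [|k /andP[IH0 IHL]] /=; first by rewrite lexx.
rewrite addr_ge0 ?(mulr_ge0 (sqr_ge0 _)) ?subr_ge0//= /gate.
by case: ifPn => [/andP[]//|_]; rewrite expr0n/= mul0r addr0.
Qed.

Definition gated_cos (rho th : R) j w :=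
  expR (rho * th ^+ 2 / 2 * (gated j w).2) * cos (th * ((gated j w).1 - x)).

(** The submartingale inequality tested on an event of the initial sigma-algebra. While the gate is
    open the position is in the window, where the cosine is nonnegative and [brownian_cos_step]
    applies; when it is closed nothing moves. The growth of the exponential factor compensates
    exactly the loss in that step. *)
Lemma gated_cos_nondecreasing (rho th : R) (A : set Omega) k : 0 < th -> th * e <= pi / 2 ->
  0 <= L -> 1 < rho -> Ft (v 0%N) A ->
  (forall w, rho * (th ^+ 2 * xi k w ^+ 2 * (v k.+1 - v k)) <= rho - 1) ->
  \int[P]_w (\1_A w * gated_cos rho th k w) <= \int[P]_w (\1_A w * gated_cos rho th k.+1 w).
Proof.
move=> th0 the L0 rho1 FA small.
pose g w := gate (gated k w) (xi k w) (v k.+1 - v k).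
pose U w := \1_A w * expR (rho * th ^+ 2 / 2 * (gated k.+1 w).2).
have [m1 m2 mg] : [/\ _, _ & Ft_measurable Ft (v k) g] := gated_measurable k.
have mA : Ft_measurable Ft (v k) (\1_A : Omega -> R).
  apply: measurable_indic; rewrite measurable_g_measurableTypeE.
    apply: (filtration_nondecreasing usual v0 _ FA).
    by elim: (k) => // j IH; exact: le_trans IH (v_nd j).
  exact: (filtration_sigma_algebra usual (v_ge0 k)).
have := @brownian_cos_step _ _ _ P Ft usual W BM (v k) (v k.+1) rho
  (expR (rho * th ^+ 2 / 2 * L)) U (fun w => th * ((gated k w).1 - x)) (fun w => th * g w)
  (v_ge0 k) (v_nd k) rho1.
have -> : \int[P]_w (\1_A w * gated_cos rho th k w) =
   \int[P]_w (U w * (cos (th * ((gated k w).1 - x)) *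
     expR (- (rho * ((th * g w) ^+ 2 * (v k.+1 - v k) / 2))))).
  apply: eq_Rintegral => w _; rewrite /gated_cos /U.
  have -> : expR (rho * th ^+ 2 / 2 * (gated k w).2) =
      expR (rho * th ^+ 2 / 2 * (gated k.+1 w).2) *
      expR (- (rho * ((th * g w) ^+ 2 * (v k.+1 - v k) / 2))).
    by rewrite -expRD; congr expR; rewrite /= -/(g w); ring.
  by ring.
have -> : \int[P]_w (\1_A w * gated_cos rho th k.+1 w) =
   \int[P]_w (U w * cos (th * ((gated k w).1 - x) + th * g w * (W (v k.+1) w - W (v k) w))).
  apply: eq_Rintegral => w _; rewrite /gated_cos /U -!mulrA; congr (_ * (_ * cos _)).
  by rewrite /= -/(g w); ring.
apply.
- apply: measurable_funM => //; apply: measurableT_comp => //.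
  apply: measurable_funM => //; apply: measurable_funD => //; apply: measurable_funM => //.
  exact: measurable_funX.
- by apply: measurable_funM => //; apply: measurable_funB.
- by apply: measurable_funM.
- move=> w; rewrite mulr_ge0 ?expR_ge0//=.
  rewrite /U -[leRHS]mul1r; apply: ler_pM; rewrite ?expR_ge0//.
  rewrite ler_expR; apply: ler_wpM2l; last by have /andP[] := gated_bound k.+1 w L0.
  by apply: divr_ge0 => //; apply: mulr_ge0; rewrite ?sqr_ge0//; lra.
- move=> w; rewrite /g /gate; case: ifPn => [/andP[Ye _]|_]; last by left; rewrite mulr0.
  right; split; last by rewrite exprMn.
  apply: cos_ge0_pihalf; rewrite -ler_norml normrM (gtr0_norm th0).
  by rewrite (le_trans _ the)// ler_wpM2l// ltW.
Qed.
End stopped_exponential.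

(** * Pathwise comparison of the gated walk with [M] *)

Lemma cos_le0_pihalf (R : realType) (y : R) : pi / 2 <= `|y| <= pi / 2 * 3 -> cos y <= 0.
Proof.
move=> /andP[y1 y2]; have -> : cos y = cos `|y|
  by have [y0|/ltW y0] := leP 0 y; [rewrite ger0_norm|rewrite ler0_norm// cosN].
rewrite -[`|y|](subrK pi) cosDpi oppr_le0 cos_ge0_pihalf//; apply/andP; split; lra.
Qed.

Lemma nondecreasing_step (R : realType) (v : nat -> R) (i j : nat) :
  (forall k, v k <= v k.+1) -> (i <= j)%N -> v i <= v j.
Proof.
by move=> v_nd /subnK <-; elim: (j - i)%N => // n IH; rewrite addSn; exact: le_trans IH (v_nd _).
Qed.

Lemma itv_grid_cell (R : realType) (v : nat -> R) (N : nat) (u : R) :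
  v 0%N <= u <= v N -> u = v 0%N \/ exists k, (k < N)%N /\ v k <= u <= v k.+1.
Proof.
elim: N => [|N IH] /andP[u0 uN]; first by left; apply/eqP; rewrite eq_le uN.
have [uN'|uN'] := leP u (v N).
  have [|->|[k [kN ku]]] := IH; [by rewrite u0 uN'|by left|right].
  by exists k; split=> //; exact: ltnW.
by right; exists N; split=> //; rewrite uN (ltW uN').
Qed.

Section gated_path.
Context (R : realType) (d : measure_display) (Omega : measurableType d) (W : R -> Omega -> R) (v : nat -> R).
Context (v_nd : forall k, v k <= v k.+1).
Context (xi : nat -> Omega -> R) (Y0 : Omega -> R) (x e e2 L kappa mesh : R) (N : nat) (w : Omega).
Context (X M : R -> R).

Local Notation gated := (gated W v xi Y0 x e L).

Let v_le i j : (i <= j)%N -> v i <= v j.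
Proof. exact: nondecreasing_step. Qed.

(* [X] approximates the increments of [M] along the grid: either [M] stays near [x], or the
   gated walk is caught in the annulus where [cos (theta (y - x)) <= 0]. *)
Lemma gated_exit :
  0 < e -> e + 3 * kappa <= e2 -> 5 * kappa <= 2 * e ->
  Y0 w = M (v 0%N) -> `|M (v 0%N) - x| < e ->
  (forall k, (k < N)%N -> X (v k.+1) - X (v k) = xi k w * (W (v k.+1) w - W (v k) w)) ->
  (forall k, (k <= N)%N -> `|(X (v k) - X (v 0%N)) - (M (v k) - M (v 0%N))| <= 2 * kappa) ->
  (forall k, v k.+1 - v k <= mesh) ->
  (forall u u', v 0%N <= u <= v N -> v 0%N <= u' <= v N -> `|u - u'| <= mesh ->
     `|M u - M u'| <= kappa) ->
  (forall k, (k <= N)%N -> (forall u, v 0%N <= u <= v k -> `|M u - x| <= e2) ->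
     \sum_(j < k) xi j w ^+ 2 * (v j.+1 - v j) <= L) ->
  (forall u, v 0%N <= u <= v N -> `|M u - x| <= e2) \/
  e <= `|(gated N w).1 - x| <= 3 * e.
Proof.
move=> e0 ee2 ke Y0M Mx XW XM vmesh Mmod sumL.
(* [Z] is the walk without gates; the gated walk follows it up to its first exit from the window and
   is frozen from then on. *)
pose Z k := M (v 0%N) + (X (v k) - X (v 0%N)).
have ZM k : (k <= N)%N -> `|Z k - M (v k)| <= 2 * kappa.
  by move=> /XM; congr (`|_| <= _); rewrite /Z; ring.
have kap0 : 0 <= kappa.
  have := Mmod (v 0%N) (v 0%N); rewrite !subrr normr0; apply; rewrite ?lexx ?v_le//.
  by apply: le_trans (vmesh 0%N); rewrite subr_ge0.
(* If the walk is inside at [v k], then [M] is controlled on the whole next cell: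
   [e + 2 kappa + kappa <= e2]. *)
have near k u : (k < N)%N -> `|Z k - x| < e -> v k <= u <= v k.+1 -> `|M u - x| <= e2.
  move=> kN Zk /andP[ku uk].
  have : `|M u - M (v k)| <= kappa.
    apply: Mmod; last by rewrite ger0_norm ?subr_ge0// (le_trans _ (vmesh k))// lerB.
      by rewrite (le_trans (v_le (leq0n k)) ku) (le_trans uk)// v_le.
    by rewrite v_le//= v_le// ltnW.
  have := ZM k (ltnW kN).
  rewrite (_ : M u - x = (M u - M (v k)) - (Z k - M (v k)) + (Z k - x)); last ring.
  move=> h1 h2; apply: le_trans (ler_normD _ _) _.
  have := ler_normB (M u - M (v k)) (Z k - M (v k)); lra.
have nearK K : (K <= N)%N -> (forall k, (k < K)%N -> `|Z k - x| < e) ->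
    forall u, v 0%N <= u <= v K -> `|M u - x| <= e2.
  move=> KN ZK u /itv_grid_cell[->|[k [kK ku]]]; last by apply: near ku; [exact: leq_trans KN|exact: ZK].
  lra.
have [stay|/existsNP[k0 /not_implyP[k0N /negP]]] := pselect (forall k, (k < N)%N -> `|Z k - x| < e).
  by left; exact: nearK stay.
rewrite -leNgt => k0e; right.
have ex : exists k, (k < N)%N && (e <= `|Z k - x|) by exists k0; rewrite k0N.
case: (ex_minnP ex) => {k0 k0N k0e ex} k /andP[kN ke'] kmin.
have ltk j : (j < k)%N -> `|Z j - x| < e.
  move=> jk; rewrite ltNge; apply/negP => je.
  by have := kmin j; rewrite (ltn_trans jk kN) je leqNgt jk => /(_ isT).
have gj j : (j <= k)%N -> gated j w = (Z j, \sum_(i < j) xi i w ^+ 2 * (v i.+1 - v i)).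
  elim: j => [_|j IH jk] /=; first by rewrite big_ord0 /Z subrr addr0 Y0M.
  rewrite IH ?(ltnW jk)//= /gate/= ltk// big_ord_recr/=.
  have jN : (j.+1 <= N)%N := leq_trans jk (ltnW kN).
  (* The clock does not close the gate: the walk has been inside so far, so [M] is within [e2] of
     [x] up to [v j.+1] and the sum is at most [L]. *)
  have := sumL _ jN; rewrite big_ord_recr/= => ->/=; last first.
    by apply: nearK => // i ij; apply: ltk; exact: leq_trans ij jk.
  by rewrite -XW// /Z; congr (_, _); ring.
have gN n : (gated (k + n)%N w).1 = Z k.
  elim: n => [|n IH]; first by rewrite addn0 gj.
  by rewrite addnS /= {1}/gate IH ltNge ke'/= mul0r addr0.
rewrite -(subnKC (ltnW kN)) gN ke'/=.
case: k => [|k] in kN ke' kmin ltk gj gN *.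
  (* The exit index is not 0, because the start is strictly inside; so there is a preceding position
     inside the window. *)
  by move: ke'; rewrite /Z subrr addr0 leNgt Mx.
have Zk := ltk k (ltnSn k).
have h1 := ZM _ (ltnW kN); have h2 := ZM k (ltnW (ltnW kN)).
have h3 : `|M (v k.+1) - M (v k)| <= kappa.
  apply: Mmod; last by rewrite ger0_norm ?subr_ge0.
    by rewrite v_le//= v_le// ltnW.
  by rewrite v_le//= v_le// ltnW// ltnW.
(* The jump out of the window is at most [2 kappa + 2 kappa + kappa <= 2 e], so the exit position is
   at distance at most [3 e]. *)
rewrite (_ : Z k.+1 - x = (Z k - x) + ((Z k.+1 - M (v k.+1)) - (Z k - M (v k))) + (M (v k.+1) - M (v k))); last ring.
apply: le_trans (ler_normD _ _) _; have := ler_normD (Z k - x) ((Z k.+1 - M (v k.+1)) - (Z k - M (v k))).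
have := ler_normB (Z k.+1 - M (v k.+1)) (Z k - M (v k)); lra.
Qed.
End gated_path.

(** * Grids adapted to a simple process *)

(** No cell contains a point of [l] in its interior, so a simple process whose jump times are in [l]
    is constant on each cell. A point of [l] inside the interval splits it, and two grids are
    concatenated. The sequence stays at [b] from index [N] on. *)
Lemma exists_grid (R : realType) (l : seq R) (mu a b : R) : 0 < mu -> a <= b ->
  exists (v : nat -> R) (N : nat),
    [/\ v 0%N = a /\ v N = b, forall k, v k <= b, forall k, v k <= v k.+1,
        forall k, v k.+1 - v k <= mu &
        forall k t, t \in l -> ~~ (v k < t < v k.+1)].
Proof.
move=> mu0; elim: l a b => [|t l IH] a b ab.
  pose N := (Num.trunc ((b - a) / mu)).+1.
  exists (fun k => Num.min (a + k%:R * mu) b), N; split.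
  - rewrite mul0r addr0 (min_idPl ab); split=> //; apply/min_idPr.
    by rewrite -lerBlDl -ler_pdivrMr// ltW// truncnS_gt.
  - by move=> k; rewrite ge_min lexx orbT.
  - move=> k; rewrite -[k.+1%:R]natr1 mulrDl mul1r addrA.
    by rewrite le_min !ge_min lexx orbT andbT lerDl (ltW mu0).
  - move=> k; rewrite -[k.+1%:R]natr1 mulrDl mul1r addrA lerBlDr addrC.
    set y := a + _; have [yb|/ltW yb] := leP y b; first by rewrite ge_min lexx.
    by rewrite ge_min lerDr (ltW mu0) orbT.
  - by [].
have [at_|ta] := ltP a t; last first.
  have [v [N [[v0 vN] vb vnd vmu vl]]] := IH a b ab.
  exists v, N; split=> // k t'; rewrite in_cons => /predU1P[->|]; last exact: vl.
  by rewrite ltNge (le_trans ta)// -v0 nondecreasing_step.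
have [tb|bt] := ltP t b; last first.
  have [v [N [[v0 vN] vb vnd vmu vl]]] := IH a b ab.
  exists v, N; split=> // k t'; rewrite in_cons => /predU1P[->|]; last exact: vl.
  by rewrite negb_and orbC -leNgt (le_trans (vb _)).
have [v1 [N1 [[v10 v1N] vb1 vnd1 vmu1 vl1]]] := IH a t (ltW at_).
have [v2 [N2 [[v20 v2N] vb2 vnd2 vmu2 vl2]]] := IH t b (ltW tb).
pose v k := if (k < N1)%N then v1 k else v2 (k - N1)%N.
have vE k : (k <= N1)%N -> v k = v1 k.
  by rewrite /v leq_eqVlt => /predU1P[->|->//]; rewrite ltnn subnn v20 v1N.
have vE2 k : (N1 <= k)%N -> v k = v2 (k - N1)%N by rewrite /v ltnNge => ->.
have cell k (Q : R -> R -> Prop) : (forall j, Q (v1 j) (v1 j.+1)) ->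
    (forall j, Q (v2 j) (v2 j.+1)) -> Q (v k) (v k.+1).
  move=> Q1 Q2; have [kN|Nk] := ltnP k N1; first by rewrite !vE ?(ltnW kN).
  by rewrite !vE2 ?(leqW Nk)// subSn.
exists v, (N1 + N2)%N; split.
- by rewrite vE// vE2 ?leq_addr// addKn.
- move=> k; have [kN|Nk] := ltnP k N1; last by rewrite vE2.
  by rewrite vE ?(ltnW kN)// (le_trans (vb1 _))// ltW.
- by move=> k; apply: (cell k (fun p q => p <= q)).
- by move=> k; apply: (cell k (fun p q => q - p <= mu)).
- move=> k t'; rewrite in_cons => /predU1P[->|t'l]; last first.
    by apply: (cell k (fun p q => ~~ (p < t' < q))) => j; [exact: vl1|exact: vl2].
  have [kN|Nk] := ltnP k N1.
    by rewrite negb_and orbC -leNgt (vE k.+1 kN) vb1.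
  have tv : t <= v k by rewrite (vE2 k Nk) -[leLHS]v20 nondecreasing_step.
  by rewrite negb_and -leNgt tv.
Qed.

Section simple_process_on_grid.
Context (R : realType) (d : measure_display) (Omega : measurableType d).
Context (P : probability Omega R) (Ft : R -> set (set Omega)).
Hypothesis usual : usual_filtration P Ft.
Context (h : simple_process Ft).

Definition simple_times : seq R := [seq simple_time h i | i <- iota 0 (simple_size h).+1].

Lemma mem_simple_times i : (i <= simple_size h)%N -> simple_time h i \in simple_times.
Proof. by move=> ih; apply: map_f; rewrite mem_iota. Qed.

Lemma simple_eval_bounded : exists C : R, forall s w, `|simple_eval h s w| <= C.
Proof.
have /choice[c hc] i : exists C, forall w, `|simple_coef h i w| <= C.
  exact: simple_coef_bounded.
exists (\sum_(i < simple_size h) c i) => s w.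
rewrite (le_trans (ler_norm_sum _ _ _))//; apply: ler_sum => i _.
rewrite normrM (le_trans _ (hc i w))// -[leRHS]mulr1 ler_wpM2l//.
by rewrite indicE normr_nat lern1 leq_b1.
Qed.

Context (a b : R) (a0 : 0 <= a) (ab : a <= b).
Hypothesis ab_times : forall t, t \in simple_times -> ~~ (a < t < b).

Let cell t : t \in simple_times -> a < b -> (t < b) = (t <= a).
Proof.
move=> /ab_times; rewrite negb_and -!leNgt => + ab'.
by case/orP => ta; [rewrite ta (le_lt_trans ta ab')|rewrite ltNge ta leNgt (lt_le_trans ab' ta)].
Qed.

Lemma simple_eval_cell w u : a < u <= b -> simple_eval h u w = simple_eval h b w.
Proof.
move=> /andP[au ub]; have ab' := lt_le_trans au ub.
apply: eq_bigr => i _; congr (_ * _); rewrite !indicE; congr (_%:R).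
have t1 := mem_simple_times (ltnW (ltn_ord i)); have t2 := mem_simple_times (ltn_ord i).
have tu t : t \in simple_times -> (t < u) = (t < b).
  move=> tt; rewrite (cell tt ab'); have [ta|ta] := leP t a; first exact: le_lt_trans ta au.
  by apply/negbTE; rewrite -leNgt (le_trans ub)// leNgt (cell tt ab') -ltNge.
by rewrite !mem_setE !in_itv/= tu//; congr (_ && _); rewrite !leNgt tu.
Qed.

(** Although evaluated at the right end [b], the coefficient is known at [a]: only terms starting
    before [b] contribute, and in a cell without interior jump times these start no later than
    [a]. *)
Lemma simple_eval_Ft_measurable : Ft_measurable Ft a (simple_eval h b).
Proof.
apply: measurable_sum => i.
have t1 := mem_simple_times (ltnW (ltn_ord i)).
have ti0 := simple_time_ge0 h i.
have [tb|tb] := ltP (simple_time h i) b; last first.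
  rewrite (_ : (fun w => _) = cst 0); first exact: measurable_cst.
  by apply/funext => w; rewrite indicE memNset ?mulr0//= in_itv/= ltNge tb.
have ta : simple_time h i <= a.
  move: (ab); rewrite le_eqVlt => /predU1P[->|ab']; first exact: ltW.
  by rewrite -(cell t1 ab').
apply: measurable_funM; last exact: measurable_cst.
apply: (Ft_measurable_le usual ti0 ta); apply/(Ft_measurable_wrt usual _ ti0).
exact: simple_coef_measurable.
Qed.

Lemma simple_integral_increment (W : R -> Omega -> R) w :
  simple_integral W h b w - simple_integral W h a w = simple_eval h b w * (W b w - W a w).
Proof.
rewrite /simple_integral /simple_eval -sumrB mulr_suml; apply: eq_bigr => i _.
have tW t : t \in simple_times ->
    W (Num.min t b) w - W (Num.min t a) w = (b <= t)%R%:R * (W b w - W a w).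
  move=> tt; move: (ab); rewrite le_eqVlt => /predU1P[->|ab']; first by rewrite !subrr mulr0.
  have [bt|tb] := leP b t.
    by rewrite (min_idPr _) ?(ltW (lt_le_trans ab' bt))// mul1r.
  have ta : t <= a by rewrite -(cell tt ab').
  by rewrite (min_idPl ta) subrr mul0r.
have t1 := tW _ (mem_simple_times (ltnW (ltn_ord i))).
have t2 := tW _ (mem_simple_times (ltn_ord i)).
set D := W b w - W a w in t1 t2 *.
transitivity (simple_coef h i w * ((W (Num.min (simple_time h i.+1) b) w - W (Num.min (simple_time h i.+1) a) w)
   - (W (Num.min (simple_time h i) b) w - W (Num.min (simple_time h i) a) w))); first ring.
rewrite t1 t2 -mulrBl -mulrA; congr (_ * (_ * _)).
rewrite indicE/= mem_setE in_itv/=.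
have tt := simple_time_nd h i.
have [bt|tb] := leP b (simple_time h i); first by rewrite (le_trans bt tt) subrr.
by rewrite subr0.
Qed.
End simple_process_on_grid.

(** * From L^2 closeness to a bound on the clock *)

Section step_integral.
Context (R : realType).
Local Notation mu := (@lebesgue_measure R).

Lemma integral_step (v xi : nat -> R) (f : R -> R) (k : nat) :
  (forall j, v j <= v j.+1) -> measurable_fun [set: R] f -> (forall u, 0 <= f u) ->
  (forall j u, (j < k)%N -> v j < u <= v j.+1 -> f u = xi j) ->
  (\int[mu]_(u in `]v 0%N, v k]) (f u)%:E = (\sum_(j < k) xi j * (v j.+1 - v j))%:E)%E.
Proof.
move=> vnd mf f0; elim: k => [|k IH] fxi.
  by rewrite big_ord0 set_itvoc0 integral_set0.
rewrite (@itv_bndbnd_setU _ _ _ (BRight (v k))) ?bnd_simp ?nondecreasing_step//.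
rewrite ge0_integral_setU//=; last 3 first.
- by apply/measurable_EFinP; exact: measurable_funTS.
- by move=> u _; rewrite lee_fin.
- apply/disj_setPRL => u /=; rewrite !in_itv/= => /andP[ku _] /andP[_]; rewrite leNgt ku//.
rewrite IH; last by move=> j u jk; apply: fxi; exact: ltnW.
rewrite big_ord_recr/= EFinD; congr (_ + _)%E.
rewrite (eq_integral (cst (xi k)%:E)); last first.
  by move=> u; rewrite inE/= in_itv/= => ku; rewrite (fxi k).
rewrite integral_cst//= lebesgue_measure_itv/= lte_fin.
have := vnd k; rewrite le_eqVlt => /predU1P[<-|->]; last by rewrite EFinM EFinB.
by rewrite ltxx subrr mule0 mulr0.
Qed.

(** The sum is the integral of [f^2] over the grid interval, and
    [f^2 <= (1 + a) g^2 + (1 + 1/a) (f - g)^2], which is the nonnegativity of the square of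
    [a g - (f - g)] divided by [a]. With [g] the path of [eta (M)], the clock of the simple process
    exceeds [K^2 T] by an arbitrarily small amount. *)
Lemma sum_step_le (v xi : nat -> R) (f g : R -> R) (k : nat) (a K kappa T : R) :
  0 < a -> (forall j, v j <= v j.+1) -> 0 <= v 0%N -> v k <= T ->
  measurable_fun [set: R] f -> measurable_fun `[0, T] g ->
  (forall j u, (j < k)%N -> v j < u <= v j.+1 -> f u = xi j) ->
  (forall u, v 0%N <= u <= v k -> `|g u| <= K) ->
  (\int[mu]_(u in `[0%R, T]) ((f u - g u) ^+ 2)%:E <= kappa%:E)%E ->
  \sum_(j < k) xi j ^+ 2 * (v j.+1 - v j) <= (1 + a) * K ^+ 2 * T + (1 + a^-1) * kappa.
Proof.
move=> a0 vnd v0 vT mf mg fxi gK Ikappa; rewrite -lee_fin.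
have vk := nondecreasing_step vnd (leq0n k).
have sub : `]v 0%N, v k] `<=` `[0, T].
  move=> u /=; rewrite !in_itv/= => /andP[u0 uk].
  by rewrite (le_trans v0 (ltW u0)) (le_trans uk vT).
have mD : measurable_fun `[0, T] (fun u => (f u - g u) ^+ 2).
  by apply: measurable_funX; apply: measurable_funB => //; exact: measurable_funTS.
have mf2 : measurable_fun [set: R] (fun u => f u ^+ 2) by exact: measurable_funX.
have fxi2 j u : (j < k)%N -> v j < u <= v j.+1 -> f u ^+ 2 = xi j ^+ 2.
  by move=> jk ju; rewrite (fxi j).
have := @integral_step v (fun j => xi j ^+ 2) (fun u => f u ^+ 2) k vnd mf2.
move=> /(_ (fun u => sqr_ge0 _) fxi2) <-.
apply: (@le_trans _ _ (\int[mu]_(u in `]v 0%N, v k])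
    (((1 + a) * K ^+ 2)%:E + (1 + a^-1)%:E * ((f u - g u) ^+ 2)%:E))%E).
  apply: ge0_le_integral => //=.
  - by move=> u _; rewrite lee_fin sqr_ge0.
  - by apply/measurable_EFinP/measurable_funTS; exact: measurable_funX.
  - apply: emeasurable_funD => //; apply: emeasurable_funM => //.
    by apply/measurable_EFinP; exact: measurable_funS mD.
  - move=> u; rewrite in_itv/= => /andP[u0 uk]; rewrite -EFinM -EFinD lee_fin.
    have gu : g u ^+ 2 <= K ^+ 2.
      by rewrite -real_normK ?num_real// lerXn2r ?nnegrE ?(le_trans _ (gK u _))// ?gK// ltW.
    have : (1 + a) * g u ^+ 2 <= (1 + a) * K ^+ 2 by rewrite ler_wpM2l// addr_ge0// ltW.
    suff : f u ^+ 2 <= (1 + a) * g u ^+ 2 + (1 + a^-1) * (f u - g u) ^+ 2 by lra.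
    have : 0 <= a^-1 * (a * g u - (f u - g u)) ^+ 2.
      by rewrite mulr_ge0 ?sqr_ge0// invr_ge0 ltW.
    have -> : a^-1 * (a * g u - (f u - g u)) ^+ 2 =
      a * g u ^+ 2 - 2 * g u * (f u - g u) + a^-1 * (f u - g u) ^+ 2 by field; lra.
    by rewrite !expr2; nra.
rewrite ge0_integralD//=; last 3 first.
- by move=> u _; rewrite lee_fin mulr_ge0 ?sqr_ge0// addr_ge0// ltW.
- by move=> u _; rewrite -EFinM lee_fin mulr_ge0 ?sqr_ge0// addr_ge0// invr_ge0 ltW.
- by apply: emeasurable_funM => //; apply/measurable_EFinP; exact: measurable_funS mD.
have aK : 0 <= (1 + a) * K ^+ 2 by rewrite mulr_ge0 ?sqr_ge0// addr_ge0// ltW.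
have aV : 0 <= 1 + a^-1 by rewrite addr_ge0// invr_ge0 ltW.
rewrite integral_cst//= ge0_integralZl//=; last 2 first.
- by apply/measurable_EFinP; exact: measurable_funS mD.
- by move=> u _; rewrite lee_fin sqr_ge0.
rewrite [leRHS]EFinD; apply: leeD.
  rewrite lebesgue_measure_itv/= lte_fin; case: ifPn => _; last first.
    by rewrite mule0 lee_fin mulr_ge0// (le_trans v0)// (le_trans vk).
  by rewrite -EFinD -EFinM lee_fin ler_wpM2l//; lra.
rewrite [leRHS]EFinM; apply: lee_wpmul2l; rewrite ?lee_fin//; apply: le_trans Ikappa.
apply: ge0_subset_integral => //=; first exact/measurable_EFinP.
by move=> u _; rewrite lee_fin sqr_ge0.
Qed.
End step_integral.

(** * Paths on a compact time interval *)

(** The retraction of the line onto [[0, T]]. Paths are continuous on [[0, +oo[] only; composed with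
    [clamp T] they become continuous on the whole line. *)
Definition clamp (R : realType) (T u : R) : R := Num.min T (Num.max 0 u).

Section clamp.
Context (R : realType) (T : R) (T0 : 0 <= T).

Lemma clamp_itv (u : R) : 0 <= clamp T u <= T.
Proof. by rewrite /clamp le_min T0 le_max lexx/= ge_min lexx. Qed.

Lemma clamp_id (u : R) : 0 <= u <= T -> clamp T u = u.
Proof. by move=> /andP[u0 uT]; rewrite /clamp (max_idPr u0) (min_idPr uT). Qed.

Lemma clampE (u : R) : clamp T u = if u <= 0 then 0 else if u <= T then u else T.
Proof.
rewrite /clamp; have [u0|u0] := leP u 0.
  by rewrite (min_idPr T0).
by have [] := leP u T.
Qed.

Lemma clamp_lipschitz (u v : R) : `|clamp T u - clamp T v| <= `|u - v|.
Proof.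
suff key (n : R) : u - v <= n -> v - u <= n -> `|clamp T u - clamp T v| <= n.
  by apply: key; [exact: ler_norm|rewrite distrC ler_norm].
move=> h1 h2; rewrite ler_norml !clampE; move: T0 => T0'.
case: (leP u 0) => u0; case: (leP v 0) => v0; case: (leP u T) => uT; case: (leP v T) => vT;
  apply/andP; split; lra.
Qed.

Lemma continuous_clamp (f : R -> R) : {within `[0, +oo[, continuous f} ->
  continuous (fun u => f (clamp T u)).
Proof.
move=> /subspace_continuousP cf u; apply/cvgrPdist_lt => e e0.
have /cvgrPdist_lt/(_ _ e0) : f t @[t --> within `[0, +oo[ (nbhs (clamp T u))] --> f (clamp T u).
  by apply: cf; rewrite /= in_itv/= andbT; case/andP: (clamp_itv u).
rewrite near_withinE => /nbhs_ballP[r /= r0 rf].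
apply/nbhs_ballP; exists r => // v uv; apply: rf.
  by rewrite /ball/= (le_lt_trans (clamp_lipschitz _ _)).
by rewrite /= in_itv/= andbT; case/andP: (clamp_itv v).
Qed.

Lemma continuous_rat (f : R -> R) (c : R) : continuous f ->
  (exists u, c < f u) <-> exists q : rat, c < f (ratr q).
Proof.
move=> cf; split=> [[u cu]|[q cq]]; last by exists (ratr q).
have /cvgrPdist_lt/(_ (f u - c)) := cf u; rewrite subr_gt0 => /(_ cu) /nbhs_ballP[r /= r0 rf].
have [q] := @rat_in_itvoo R u (u + r) ltac:(lra).
rewrite in_itv/= => /andP[uq qr]; exists q.
have := rf (ratr q); rewrite /ball/= distrC gtr0_norm ?subr_gt0// => /(_ ltac:(lra)).
by have := ler_norm (f u - f (ratr q)); lra.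
Qed.

Lemma uniform_continuity (f : R -> R) (a b kappa : R) : continuous f -> 0 < kappa ->
  exists2 mesh : R, 0 < mesh & forall u v, a <= u <= b -> `|u - v| < mesh -> `|f u - f v| <= kappa.
Proof.
move=> cf k0; have /compact_near_coveringP cov := @segment_compact R a b.
have {cov} H : \forall m \near 0^'+, `[a, b]%classic `<=` (fun u => forall v, `|u - v| < m -> `|f u - f v| <= kappa).
  apply: cov => u _; have /cvgrPdist_lt/(_ (kappa / 2)) := cf u.
  rewrite divr_gt0// => /(_ isT) /nbhs_ballP[r /= r0 rf].
  exists (ball u (r / 2), [set m | 0 < m < r / 2]) => /=.
    split; first by apply: nbhsx_ballx; rewrite divr_gt0.
    near=> m; apply/andP; split; near: m; first exact: nbhs_right_gt.
    by apply: nbhs_right_lt; rewrite divr_gt0.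
  move=> [u' m] /= [uu' /andP[m0 mr]] v u'v.
  have h1 : `|f u - f u'| < kappa / 2 by apply: rf; rewrite /ball/= in uu' *; lra.
  have h2 : `|f u - f v| < kappa / 2.
    apply: rf; rewrite /ball/= in uu' *.
    by rewrite (_ : u - v = (u - u') + (u' - v)) 1?(le_lt_trans (ler_normD _ _)); lra.
  rewrite (_ : f u' - f v = (f u - f v) - (f u - f u')); last ring.
  by have := ler_normB (f u - f v) (f u - f u'); lra.
have [m [m0 Hm]] := @filter_ex _ (0:R)^'+ _ _ (filterI (nbhs_right_gt 0) H).
by exists m => // u v uab; apply: Hm; rewrite /= in_itv.
Unshelve. all: by end_near. Qed.
End clamp.

(** * Measurability of suprema and a uniform modulus of continuity *)

Section path_measurability.
Context (R : realType) (d : measure_display) (Omega : measurableType d).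
Context (D : R -> Omega -> R) (mD : forall u, 0 <= u -> measurable_fun setT (D u)).
Context (cD : continuous_paths D) (T : R) (T0 : 0 <= T).

Let cDc w : continuous (fun u => D (clamp T u) w).
Proof. exact: (@continuous_clamp R T T0 (fun u => D u w) (@cD w)). Qed.

Lemma measurable_gt_norm (c u : R) : 0 <= u -> measurable [set w | c < `|D u w|].
Proof.
move=> u0; have : measurable_fun setT (fun w => `|D u w|) by apply: measurableT_comp => //; exact: mD.
move=> /(_ measurableT `]c, +oo[%classic (measurable_itv _)); rewrite setTI.
by congr measurable; apply/seteqP; split=> w; rewrite /= in_itv/= andbT.
Qed.

Lemma measurable_lt_sup_norm (c : R) :
  measurable [set w | c%:E < ereal_sup [set `|D s w|%:E | s in `[0%R, T]]]%E.
Proof.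
rewrite (_ : [set w | _] = \bigcup_(q : rat) [set w | c < `|D (clamp T (ratr q)) w|]).
  apply: bigcupT_measurable_rat => q; apply: measurable_gt_norm.
  by have /andP[] := clamp_itv T0 (ratr q).
apply/seteqP; split=> w /=.
  move=> /ereal_sup_gt[_ [s + <-]]; rewrite /= in_itv/= lte_fin => sT cs.
  have cn : continuous (fun u => `|D (clamp T u) w|).
    by move=> u; apply: cvg_norm; exact: cDc.
  have [|q cq] := (@continuous_rat _ _ c cn).1; first by exists s; rewrite clamp_id.
  by exists q.
move=> [q _] cq; apply: (@lt_le_trans _ _ `|D (clamp T (ratr q)) w|%:E); first by rewrite lte_fin.
apply: ereal_sup_ubound; exists (clamp T (ratr q)) => //=.
by rewrite in_itv/= clamp_itv.
Qed.

Lemma measurable_le_sup_norm (c : R) :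
  measurable [set w | c%:E <= ereal_sup [set `|D s w|%:E | s in `[0%R, T]]]%E.
Proof.
rewrite (_ : [set w | _] = \bigcap_n [set w | ((c - n.+1%:R^-1)%:E <
    ereal_sup [set `|D s w|%:E | s in `[0%R, T]])%E]).
  by apply: bigcapT_measurable => n; exact: measurable_lt_sup_norm.
apply/seteqP; split=> w /=.
  move=> cS n _; apply: lt_le_trans cS.
  by rewrite lte_fin ltrBlDr ltrDl invr_gt0.
move=> cS; apply/lee_addgt0Pr => e e0.
have [n ne] : exists n, n.+1%:R^-1 < e.
  exists (Num.trunc e^-1).
  by rewrite -[ltRHS]invrK ltf_pV2 ?posrE ?invr_gt0// truncnS_gt.
apply: (@le_trans _ _ ((c - n.+1%:R^-1)%:E + e%:E)%E); last by rewrite leeD2r// ltW// cS.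
by rewrite -EFinD lee_fin -addrA lerDl addrC subr_ge0 ltW.
Qed.

(** Each path is uniformly continuous on [[0, T]], but with a mesh depending on the path. The events
    that some rational pair closer than [1 / (n + 1)] oscillates by more than [kappa] decrease to
    the empty set, so one of them has probability at most [gamma]; density of the rationals extends
    the estimate to real pairs. *)
Lemma modulus_of_continuity (P : probability Omega R) (kappa gamma : R) : 0 < kappa -> 0 < gamma ->
  exists (mesh : R) (B : set Omega), [/\ 0 < mesh, measurable B, (P B <= gamma%:E)%E &
    forall w, ~ B w -> forall u v, 0 <= u <= T -> 0 <= v <= T -> `|u - v| < mesh ->
      `|D u w - D v w| <= kappa].
Proof.
move=> k0 g0.
have cl q : 0 <= clamp T q by have /andP[] := clamp_itv T0 q.
pose f w u := D (clamp T u) w.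
have cf w : continuous (f w) by exact: cDc.
pose B n := \bigcup_(p : rat) \bigcup_(q in [set q : rat | `|ratr p - ratr q| < n.+1%:R^-1 :> R])
  [set w | kappa < `|f w (ratr p) - f w (ratr q)|].
have mB n : measurable (B n).
  apply: bigcupT_measurable_rat => p; rewrite bigcup_mkcond; apply: bigcupT_measurable_rat => q.
  case: ifPn => _ //.
  have : measurable_fun setT (fun w => `|f w (ratr p) - f w (ratr q)|).
    by apply: measurableT_comp => //; apply: measurable_funB; exact: mD.
  move=> /(_ measurableT `]kappa, +oo[%classic (measurable_itv _)); rewrite setTI.
  by congr measurable; apply/seteqP; split=> w; rewrite /= in_itv/= andbT.
have B0 : \bigcap_n B n = set0.
  apply/seteqP; split=> // w Bw.
  have [mesh mesh0 fm] := uniform_continuity 0 T (cf w) k0.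
  have [n ne] : exists n, n.+1%:R^-1 < mesh.
    exists (Num.trunc mesh^-1).
    by rewrite -[ltRHS]invrK ltf_pV2 ?posrE ?invr_gt0// truncnS_gt.
  have [p _ [q pq]] := Bw n I; rewrite /= ltNge => /negP; apply.
  have := fm (clamp T (ratr p)) (clamp T (ratr q)) (clamp_itv T0 _).
  have clK q' : clamp T (clamp T q') = clamp T q' by rewrite clamp_id// clamp_itv.
  rewrite /f !clK; apply.
  by rewrite (le_lt_trans (clamp_lipschitz T0 _ _))// (lt_trans pq).
have : P (B n) @[n --> \oo] --> 0%E.
  rewrite -(measure0 P) -B0; apply: nonincreasing_cvg_mu => //.
  - by rewrite (le_lt_trans (probability_le1 P (mB 0%N)))// ltry.
  - exact: bigcap_measurable.
  - move=> i j ij; apply/subsetPset => w [p _ [q /= pq fpq]]; exists p => //; exists q => //=.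
    by rewrite (lt_le_trans pq)// lef_pV2 ?posrE// ler_nat.
move=> /fine_cvgP[_] /cvgrPdist_lt/(_ _ g0)[n _ /(_ n (leqnn n))] /=.
rewrite sub0r normrN ger0_norm ?fine_ge0// => Bg.
exists n.+1%:R^-1, (B n); split=> //.
  by rewrite -[P _]fineK ?fin_num_measure// lee_fin ltW.
move=> w nB u v uT vT uv; rewrite leNgt; apply/negP => kuv; apply: nB.
have [mesh meshE] : exists mesh : R, mesh = n.+1%:R^-1 by exists n.+1%:R^-1.
rewrite /B -meshE in uv *.
pose g := `|D u w - D v w| - kappa; have gg : 0 < g / 2 by rewrite divr_gt0// subr_gt0.
have fu : f w u = D u w by rewrite /f clamp_id.
have fv : f w v = D v w by rewrite /f clamp_id.
have /cvgrPdist_lt/(_ _ gg)/nbhs_ballP[r1 /= r10 fr1] := cf w u.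
have /cvgrPdist_lt/(_ _ gg)/nbhs_ballP[r2 /= r20 fr2] := cf w v.
pose r := Num.min (Num.min r1 r2) ((mesh - `|u - v|) / 2).
have r0 : 0 < r by rewrite !lt_min r10 r20/= divr_gt0// subr_gt0.
have rat_near (y : R) : exists p : rat, `|y - ratr p| < r.
  have [p] := @rat_in_itvoo R y (y + r) ltac:(lra).
  by rewrite in_itv/= => /andP[yp pr]; exists p; rewrite ltr0_norm; lra.
have [p up] := rat_near u; have [q vq] := rat_near v.
have : r <= r1 /\ r <= r2 /\ r <= (mesh - `|u - v|) / 2 by rewrite /r !ge_min !lexx/= !orbT.
move=> [rr1 [rr2 rn]].
exists p => //; exists q => /=.
  rewrite (_ : ratr p - ratr q = (u - v) + ((v - ratr q) - (u - ratr p))); last ring.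
  have := ler_normD (u - v) ((v - ratr q) - (u - ratr p)).
  by have := ler_normB (v - ratr q) (u - ratr p); lra.
have h1 := fr1 _ (lt_le_trans up rr1); have h2 := fr2 _ (lt_le_trans vq rr2).
rewrite fu in h1; rewrite fv in h2.
have := ler_normD (f w (ratr p) - f w (ratr q)) ((D u w - f w (ratr p)) - (D v w - f w (ratr q))).
have := ler_normB (D u w - f w (ratr p)) (D v w - f w (ratr q)).
rewrite (_ : f w (ratr p) - f w (ratr q) + _ = D u w - D v w); last ring.
rewrite /g in h1 h2; lra.
Qed.
End path_measurability.

(** * Measurability of the approximation errors *)

Section integral_measurability.
Context (R : realType) (d : measure_display) (Omega : measurableType d).
Context (P : probability Omega R) (Ft : R -> set (set Omega)).
Hypothesis usual : usual_filtration P Ft.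
Local Notation mu := (@lebesgue_measure R).

(** Progressive measurability speaks of [[0, T]] only. Extended by 0, the process is jointly
    measurable on the whole product, as Tonelli's theorem requires. *)
Lemma progressively_measurable_restrict (H : R -> Omega -> R) (T : R) : 0 <= T ->
  progressively_measurable Ft H ->
  measurable_fun [set: measurableTypeR R * Omega]
    (fun z => if 0 <= z.1 <= T then H z.1 z.2 else 0 : R).
Proof.
move=> T0 mH _ B mB; rewrite setTI.
have mS B' : measurable B' -> measurable [set z : measurableTypeR R * Omega | 0 <= z.1 <= T /\ B' (H z.1 z.2)].
  move=> mB'; have := mH T T0 B' mB'; apply: smallest_sub.
    exact: sigma_algebra_measurable.
  move=> _ [A mA [E FE <-]]; apply: measurableX => //.
  exact: (filtration_measurable usual T0).
rewrite (_ : _ @^-1` B = [set z | 0 <= z.1 <= T /\ B (H z.1 z.2)] `|`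
    (~` [set z | 0 <= z.1 <= T /\ setT (H z.1 z.2)] `&` [set _ | B 0])).
  apply: measurableU; first exact: mS.
  apply: measurableI; first by apply: measurableC; exact: mS.
  have [B0|B0] := pselect (B 0).
    by rewrite (_ : [set _ | _] = setT)//; apply/seteqP; split.
  by rewrite (_ : [set _ | _] = set0)//; apply/seteqP; split.
apply/seteqP; split=> z /=.
  case: ifPn => [zT Bz|zT B0]; first by left.
  by right; split=> // -[].
move=> [[-> //]|[zT B0]].
by case: ifPn => // zT'; exfalso; apply: zT.
Qed.

Lemma measurable_simple_eval (h : simple_process Ft) :
  measurable_fun [set: measurableTypeR R * Omega] (fun z => simple_eval h z.1 z.2).
Proof.
apply: measurable_sum => i; apply: measurable_funM.
  have t0 := simple_time_ge0 h i.
  have mc : measurable_fun setT (simple_coef h i).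
    apply: (Ft_measurable_measurable usual t0); apply/(Ft_measurable_wrt usual _ t0).
    exact: simple_coef_measurable.
  exact: (measurableT_comp mc measurable_snd).
by apply: (measurableT_comp (measurable_indic _) measurable_fst).
Qed.

Lemma measurable_integral_sqr_dist (h : simple_process Ft) (H : R -> Omega -> R) (T : R) :
  0 <= T -> progressively_measurable Ft H ->
  measurable_fun [set: Omega]
    (fun w => \int[mu]_(s in `[0%R, T]) ((simple_eval h s w - H s w) ^+ 2)%:E)%E.
Proof.
move=> T0 mH.
pose f (z : measurableTypeR R * Omega) : \bar R :=
  (((simple_eval h z.1 z.2 - (if 0 <= z.1 <= T then H z.1 z.2 else 0)) ^+ 2 * \1_`[0, T] z.1)%R)%:E.
have mf : measurable_fun setT f.
  apply/measurable_EFinP; apply: measurable_funM.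
    apply: measurable_funX; apply: measurable_funB; first exact: measurable_simple_eval.
    exact: progressively_measurable_restrict.
  by apply: (measurableT_comp (measurable_indic _) measurable_fst).
have f0 z : (0 <= f z)%E by rewrite lee_fin mulr_ge0 ?sqr_ge0.
have := measurable_fun_fubini_tonelli_G (m1 := mu) f mf f0.
apply: eq_measurable_fun => w _; rewrite /fubini_G [RHS]integral_mkcond.
apply: eq_integral => s _; rewrite /f /patch /= indicE mem_setE in_itv/=.
by case: ifPn; rewrite ?mulr1 ?mulr0.
Qed.
End integral_measurability.

Section simple_integral.
Context (R : realType) (d : measure_display) (Omega : measurableType d).
Context (P : probability Omega R) (Ft : R -> set (set Omega)).
Hypothesis usual : usual_filtration P Ft.
Context (W : R -> Omega -> R) (BM : brownian_motion P Ft W) (h : simple_process Ft).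

Lemma adapted_measurable (X : R -> Omega -> R) u : adapted Ft X -> 0 <= u -> measurable_fun setT (X u).
Proof. by move=> aX u0; apply/(Ft_measurable_measurable usual u0)/(Ft_measurable_wrt usual _ u0)/aX. Qed.

Lemma measurable_simple_integral u : 0 <= u -> measurable_fun setT (simple_integral W h u).
Proof.
move=> u0; apply: measurable_sum => i.
have t0 := simple_time_ge0 h i; have t0' := simple_time_ge0 h i.+1.
have mc : measurable_fun setT (simple_coef h i).
  apply: (Ft_measurable_measurable usual t0); apply/(Ft_measurable_wrt usual _ t0).
  exact: simple_coef_measurable.
apply: measurable_funM => //; apply: measurable_funB;
  by apply: adapted_measurable; [exact: brownian_adapted BM|rewrite le_min u0 ?t0 ?t0'].
Qed.

Lemma continuous_simple_integral : continuous_paths (simple_integral W h).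
Proof.
move=> w; have cc t : 0 <= t -> continuous (fun s => W (clamp t s) w).
  by move=> t0; exact: (@continuous_clamp R t t0 (fun u => W u w) (@brownian_continuous _ _ _ _ _ _ BM w)).
have c1 : continuous (fun s => \sum_(i < simple_size h) simple_coef h i w *
    (W (clamp (simple_time h i.+1) s) w - W (clamp (simple_time h i) s) w)).
  rewrite -fct_sumE; elim/big_ind: _ => [|f g cf cg|i _] s; first exact: cvg_cst.
    by apply: cvgD; [exact: cf|exact: cg].
  apply: cvgM; first exact: cvg_cst.
  by apply: cvgB; apply: cc; exact: simple_time_ge0.
apply: (subspace_eq_continuous _ (continuous_subspaceT c1)) => s.
rewrite inE/= in_itv/= andbT => s0; rewrite /simple_integral.
by apply: eq_bigr => i _; rewrite /clamp (max_idPr s0).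
Qed.
End simple_integral.

(** * Auxiliary estimates on cosines, indicators and constants *)

Lemma cos_norm (R : realType) (y : R) : cos `|y| = cos y.
Proof. by have [y0|/ltW y0] := leP 0 y; [rewrite ger0_norm|rewrite ler0_norm// cosN]. Qed.

Lemma le_cos_norm (R : realType) (y z : R) : `|y| <= z -> z <= pi -> cos z <= cos y.
Proof.
rewrite -[cos y]cos_norm le_eqVlt => /predU1P[->//|yz] zpi.
rewrite ltW// ltr_cos// in_itv/= ?normr_ge0 ?zpi//=.
  by rewrite (le_trans (ltW yz)).
by rewrite (le_trans (normr_ge0 y) (ltW yz)).
Qed.

Section indicator.
Context d (T : measurableType d) (R : realType) (P : probability T R).

Lemma integrable_cst_indic (c : R) (Q : set T) : measurable Q ->
  P.-integrable setT (EFin \o (fun w => c * \1_Q w)).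
Proof.
move=> mQ; apply: (@integrable_le_cst _ _ _ _ _ `|c|).
  by apply: measurable_funM => //; exact: measurable_indic.
move=> w; rewrite normrM -[leRHS]mulr1 ler_wpM2l// indicE.
by case: (_ \in _); rewrite ?normr1 ?normr0.
Qed.

Lemma Rintegral_cst_indic (c : R) (Q : set T) : measurable Q ->
  \int[P]_w (c * \1_Q w) = c * fine (P Q).
Proof.
move=> mQ; rewrite RintegralZl//.
  by rewrite /Rintegral integral_indic// setIT.
have := integrable_cst_indic 1 mQ.
by apply: eq_integrable => // w _ /=; rewrite mul1r.
Qed.
End indicator.

Lemma cvge0_near (R : realType) (u : nat -> \bar R) (e : R) : 0 < e ->
  u n @[n --> \oo] --> 0%E -> exists N, forall n, (N <= n)%N -> (u n <= e%:E)%E.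
Proof.
move=> e0 /fine_cvgP[[N1 _ fu] /cvgrPdist_lt/(_ _ e0)[N2 _ ue]].
exists (maxn N1 N2) => n; rewrite geq_max => /andP[n1 n2].
rewrite -(fineK (fu n n1)) lee_fin ltW// (le_lt_trans (ler_norm _))//.
by have := ue n n2; rewrite /= sub0r normrN.
Qed.

Lemma splitting_constants (R : realFieldType) (X L : R) : 0 <= X -> X < L ->
  exists a k : R, [/\ 0 < a, 0 < k & (1 + a) * X + (1 + a^-1) * k <= L].
Proof.
move=> X0 XL; have cancel (b D : R) : 0 < b -> b * (D / (2 * b)) = D / 2.
  by move=> b0; field; rewrite gt_eqF.
have X1 : 0 < X + 1 by rewrite ltr_wpDl.
(* The two error terms take half of the gap [L - X] each; the denominator [X + 1] covers the case
   [X = 0]. *)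
pose a := (L - X) / (2 * (X + 1)).
have a0 : 0 < a by rewrite divr_gt0 ?subr_gt0// mulr_gt0.
have aV : 0 < 1 + a^-1 by rewrite addr_gt0// invr_gt0.
exists a, ((L - X) / (2 * (1 + a^-1))); split=> //.
  by rewrite divr_gt0 ?subr_gt0// mulr_gt0.
rewrite (cancel _ _ aV); have := cancel _ (L - X) X1; rewrite -/a.
by clearbody a; clear aV; lra.
Qed.

(** * Probability of staying near [x] *)

Section staying.
Context (R : realType) (d : measure_display) (Omega : measurableType d).
Context (P : probability Omega R) (Ft : R -> set (set Omega)).
Hypothesis usual : usual_filtration P Ft.
Context (W M : R -> Omega -> R) (BM : brownian_motion P Ft W) (eta : R -> R) (m : R).
Context (sol : sde_solution P Ft eta m W M) (meta : measurable_fun [set: R] eta).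
Local Notation mu := (@lebesgue_measure R).

(** The definition of the Ito integral enters here only: one index makes both errors small outside a
    measurable event, to which each error contributes at most [gamma / 2]. *)
Lemma approximating_simple_process (T kappa kappa2 gamma : R) :
  0 <= T -> 0 < kappa -> 0 < kappa2 -> 0 < gamma ->
  exists (h : simple_process Ft) (B : set Omega),
    [/\ measurable B, (P B <= gamma%:E)%E & forall w, ~ B w ->
      (\int[mu]_(u in `[0%R, T]) ((simple_eval h u w - eta (M u w)) ^+ 2)%:E <= kappa2%:E)%E /\
      forall u, 0 <= u <= T -> `|simple_integral W h u w - (M u w - m)| <= kappa].
Proof.
move=> T0 k0 k20 g0; have aM : adapted Ft M by case: sol.
have ito := sde_integral sol.
have [h hP] := ito_approximation ito.
have [/(_ _ k20) + /(_ _ k0)] := hP T T0.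
have mI n : measurable [set w | kappa2%:E <= \int[mu]_(s in `[0%R, T]) ((simple_eval (h n) s w - eta (M s w)) ^+ 2)%:E]%E.
  have := measurable_integral_sqr_dist usual (h n) T0 (ito_integrand_progressive ito).
  move=> /(_ measurableT `[kappa2%:E, +oo[%classic (emeasurable_itv _)).
  rewrite setTI; congr measurable; apply/seteqP; split=> w /=; rewrite in_itv/= ?andbT//.
have mD n u : 0 <= u -> measurable_fun setT (fun w => simple_integral W (h n) u w - (M u w - m)).
  move=> u0; apply: measurable_funB; first exact: (measurable_simple_integral usual BM _ u0).
  by apply: measurable_funB => //; exact: (adapted_measurable usual aM u0).
have cD n : continuous_paths (fun u w => simple_integral W (h n) u w - (M u w - m)).
  move=> w; apply: within_continuousB; first exact: (continuous_simple_integral BM).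
  exact: (ito_continuous ito).
have mS n := measurable_le_sup_norm (mD n) (cD n) T0 kappa.
have g20 : 0 < gamma / 2 by rewrite divr_gt0.
move=> /(cvge0_near g20)[n1 hn1] /(cvge0_near g20)[n2 hn2].
pose n := maxn n1 n2.
exists (h n), ([set w | kappa2%:E <= \int[mu]_(s in `[0%R, T]) ((simple_eval (h n) s w - eta (M s w)) ^+ 2)%:E]%E
  `|` [set w | kappa%:E <= ereal_sup [set `|simple_integral W (h n) s w - (M s w - m)|%:E | s in `[0%R, T]]]%E).
split; first exact: measurableU.
  rewrite (le_trans (measureU2 P (mI n) (mS n)))//.
  by rewrite [gamma]splitr EFinD leeD ?hn1 ?hn2 ?leq_maxl ?leq_maxr.
move=> w /not_orP[/= /negP + /negP]; rewrite -!ltNge => /ltW Iw Sw; split=> // u uT.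
rewrite -lee_fin ltW// (le_lt_trans _ Sw)//; apply: ereal_sup_ubound.
by exists u => //=; rewrite in_itv.
Qed.

(** Both sides bound the mean of the submartingale on [A]: from below at time [s], where the clock
    is 0 and the cosine at least [cos (theta dl)], and from above at time [T]. The term [gamma] pays
    for the paths that are badly approximated. [S] may be any event containing the staying paths of
    [A]. *)
Lemma staying_gamma (s T x e1 e2 dl K L rho gamma : R) (A S : set Omega) :
  0 <= s <= T -> Ft s A -> measurable S -> 0 < e1 -> e1 < e2 -> 0 <= dl < e1 ->
  0 <= K -> K ^+ 2 * T < L -> (forall y, `|y - x| <= e2 -> `|eta y| <= K) ->
  (forall w, A w -> `|M s w - x| <= dl) ->
  (forall w, A w -> (forall u, s <= u <= T -> `|M u w - x| <= e2) -> S w) ->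
  1 < rho -> 0 < gamma ->
  cos (pi / (2 * e1) * dl) * fine (P A) <=
  expR (rho * (pi / (2 * e1)) ^+ 2 / 2 * L) * (fine (P (A `&` S)) + gamma).
Proof.
move=> /andP[s0 sT] FA mS e10 e12 /andP[dl0 dle] K0 KL etaK Adl AS rho1 g0.
have T0 := le_trans s0 sT.
have aM : adapted Ft M by case: sol.
have cM : continuous_paths M by case: sol.
have mA : measurable A := filtration_measurable usual s0 FA.
set th := pi / (2 * e1); have th0 : 0 < th by rewrite divr_gt0 ?pi_gt0// mulr_gt0.
have the : th * e1 = pi / 2 by rewrite /th; field; rewrite gt_eqF.
have L0 : 0 <= L by rewrite (le_trans _ (ltW KL))// mulr_ge0 ?sqr_ge0.
(* The first bound keeps [M] within [e2] while the walk is inside the window, the second limits the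
   jump at exit. *)
pose kappa := Num.min ((e2 - e1) / 3) (2 * e1 / 5).
have kap0 : 0 < kappa by rewrite lt_min !divr_gt0 ?subr_gt0 ?mulr_gt0.
have [kap1 kap2] : e1 + 3 * kappa <= e2 /\ 5 * kappa <= 2 * e1.
  have : kappa <= (e2 - e1) / 3 by rewrite ge_min lexx.
  have : kappa <= 2 * e1 / 5 by rewrite ge_min lexx orbT.
  by move=> h1 h2; split; lra.
have KT0 : 0 <= K ^+ 2 * T by rewrite mulr_ge0 ?sqr_ge0.
have [a [kappa2 [a0 kap20 aL]]] := splitting_constants KT0 KL; rewrite mulrA in aL.
have g20 : 0 < gamma / 2 by rewrite divr_gt0.
have mM u (u0 : 0 <= u) : measurable_fun setT (M u) := adapted_measurable usual aM u0.
have [mesh0 [B0 [mesh00 mB0 PB0 B0mod]]] := modulus_of_continuity mM cM T0 P kap0 g20.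
have [h [B1 [mB1 PB1 hB1]]] := approximating_simple_process T0 kap0 kap20 g20.
have [C hC] := simple_eval_bounded h.
have C1 : 0 < rho * th ^+ 2 * (C ^+ 2 + 1).
  by apply: mulr_gt0; [apply: mulr_gt0; [lra|exact: exprn_gt0]|rewrite ltr_wpDl// sqr_ge0].
(* Half of [mesh0] turns a weak inequality between times into a strict one; the other bound gives
   the smallness of each step, with [C ^+ 2 + 1] positive even when [C] is 0. *)
pose mesh := Num.min (mesh0 / 2) ((rho - 1) / (rho * th ^+ 2 * (C ^+ 2 + 1))).
have mesh_gt0 : 0 < mesh by rewrite lt_min !divr_gt0// subr_gt0.
have [v [N [[v0 vN] vT vnd vmesh vtimes]]] := exists_grid (simple_times h) mesh_gt0 sT.
have v_ge k : s <= v k by rewrite -v0 nondecreasing_step.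
have v0_ge0 : 0 <= v 0%N by rewrite v0.
have vk_ge0 k : 0 <= v k := le_trans s0 (v_ge k).
pose xi k := simple_eval h (v k.+1).
have vt k t : t \in simple_times h -> ~~ (v k < t < v k.+1) by exact: vtimes.
have mxi k : Ft_measurable Ft (v k) (xi k).
  exact: (simple_eval_Ft_measurable usual (vnd k) (vt k)).
have mY0 : Ft_measurable Ft (v 0%N) (M s).
  by rewrite v0; apply/(Ft_measurable_wrt usual _ s0)/aM.
pose V k w := gated_cos W v xi (M s) x e1 L rho th k w.
have small k w : rho * (th ^+ 2 * xi k w ^+ 2 * (v k.+1 - v k)) <= rho - 1.
  have xiC : xi k w ^+ 2 <= C ^+ 2 + 1.
    have h1 := hC (v k.+1) w; have h2 : 0 <= C := le_trans (normr_ge0 _) h1.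
    rewrite (le_trans _ (_ : C ^+ 2 <= _)) ?lerDl//.
    by rewrite -real_normK ?num_real// lerXn2r ?nnegrE.
  have dv : v k.+1 - v k <= (rho - 1) / (rho * th ^+ 2 * (C ^+ 2 + 1)).
    by rewrite (le_trans (vmesh k))// ge_min lexx orbT.
  rewrite ler_pdivlMr// in dv; apply: le_trans dv.
  have dv0 : 0 <= v k.+1 - v k by rewrite subr_ge0.
  have -> : rho * (th ^+ 2 * xi k w ^+ 2 * (v k.+1 - v k)) =
    (v k.+1 - v k) * ((rho * th ^+ 2) * xi k w ^+ 2) by ring.
  apply: ler_wpM2l => //; apply: ler_wpM2l => //.
  by apply: mulr_ge0; [lra|exact: sqr_ge0].
have chain k : \int[P]_w (\1_A w * V 0%N w) <= \int[P]_w (\1_A w * V k w).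
  elim: k => // k IH; apply: (le_trans IH).
  apply: (gated_cos_nondecreasing usual BM v0_ge0 vnd mxi mY0) => //.
    by rewrite the.
  by rewrite v0.
have exp_le k w : expR (rho * th ^+ 2 / 2 * (gated W v xi (M s) x e1 L k w).2) <= expR (rho * th ^+ 2 / 2 * L).
  rewrite ler_expR ler_wpM2l//.
    by apply: divr_ge0 => //; apply: mulr_ge0; [lra|exact: sqr_ge0].
  by have /andP[] := gated_bound W vnd xi (M s) x e1 k w L0.
have V_norm1 k w : `|V k w| <= expR (rho * th ^+ 2 / 2 * L).
  rewrite (le_trans _ (exp_le k w))// /V /gated_cos normrM ger0_norm ?expR_ge0//.
  by rewrite -[leRHS]mulr1 ler_wpM2l ?expR_ge0 ?cos_max.
have V_norm k w : `|\1_A w * V k w| <= expR (rho * th ^+ 2 / 2 * L).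
  by rewrite indicE; case: (_ \in _); rewrite ?mul1r// mul0r normr0 expR_ge0.
have mV k : measurable_fun setT (fun w => \1_A w * V k w).
  apply: measurable_funM; first exact: measurable_indic.
  have [m1 m2 _] := gated_measurable usual BM v0_ge0 vnd mxi mY0 x e1 L k.
  have {}m1 := Ft_measurable_measurable usual (vk_ge0 k) m1.
  have {}m2 := Ft_measurable_measurable usual (vk_ge0 k) m2.
  apply: measurable_funM; first by apply: measurableT_comp => //; exact: measurable_funM.
  apply: measurableT_comp; first exact: measurable_cos.
  by apply: measurable_funM => //; exact: measurable_funB.
have iV k : P.-integrable setT (EFin \o (fun w => \1_A w * V k w)).
  exact: integrable_le_cst (mV k) (V_norm k).
pose E := expR (rho * th ^+ 2 / 2 * L).
have mAS := measurableI _ _ mA mS; have mB := measurableU _ _ mB0 mB1.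
have iI Q c (mQ : measurable Q) := integrable_cst_indic P c mQ.
have intI Q c (mQ : measurable Q) := Rintegral_cst_indic P c mQ.
have start : cos (th * dl) * fine (P A) <= \int[P]_w (\1_A w * V 0%N w).
  rewrite -intI//; apply: le_Rintegral => //; first exact: iI.
  move=> w _; rewrite mulrC !indicE.
  have [/set_mem/Adl Mx|_] := boolP (w \in A); last by rewrite !mul0r.
  rewrite !mul1r.
  rewrite /V /gated_cos/= mulr0 expR0 mul1r; apply: le_cos_norm.
    by rewrite normrM (gtr0_norm th0) ler_wpM2l// ltW.
  rewrite (le_trans (ler_wpM2l (ltW th0) (ltW dle)))// the ler_pdivrMr// ler_peMr ?pi_ge0//.
  by rewrite ler1n.
apply: (le_trans start); apply: (le_trans (chain N)).
(* On exceptional and on staying paths the integrand is at most [E]; on the remaining paths of [A]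
   the walk ends in the annulus, where it is nonpositive. *)
have fin : \int[P]_w (\1_A w * V N w) <= \int[P]_w (E * \1_(A `&` S) w + E * \1_(B0 `|` B1) w).
  apply: le_Rintegral => //.
    exact: (integrableD measurableT (iI _ E mAS) (iI _ E mB)).
  move=> w _; rewrite -mulrDr.
  have [Bw|nBw] := pselect ((B0 `|` B1) w).
    rewrite (le_trans (ler_norm _))// (le_trans (V_norm _ _))//.
    by rewrite -[leLHS]mulr1 ler_wpM2l ?expR_ge0// [X in _ + X]indicE mem_set//= lerDr.
  have E0 : 0 <= E := expR_ge0 _.
  rewrite [\1_A w]indicE; have [/set_mem Aw|_] := boolP (w \in A); last first.
    by rewrite mul0r mulr_ge0// addr_ge0.
  rewrite mul1r; move: nBw => /not_orP[/B0mod Mmod /hB1[Ih Xh]].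
  have := @gated_exit R d Omega W v vnd xi (M s) x e1 e2 L kappa mesh N w
    (fun u => simple_integral W h u w) (fun u => M u w) e10 kap1 kap2.
  rewrite v0 => /(_ erefl (le_lt_trans (Adl w Aw) dle)).
  case.
  - by move=> k _; rewrite (simple_integral_increment (vnd k) (vt k)).
  - move=> k _.
    have vk0T : 0 <= v k <= T by rewrite vk_ge0 vT.
    have s0T : 0 <= s <= T by rewrite s0 sT.
    have := ler_normB (simple_integral W h (v k) w - (M (v k) w - m))
      (simple_integral W h s w - (M s w - m)).
    rewrite (_ : _ - (simple_integral W h s w - (M s w - m)) =
      simple_integral W h (v k) w - simple_integral W h s w - (M (v k) w - M s w)); last ring.
    by have := Xh _ vk0T; have := Xh _ s0T; lra.
  - exact: vmesh.
  - move=> u u' /andP[su uT] /andP[su' uT'] uu'; rewrite vN in uT uT'; apply: Mmod.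
    + by rewrite (le_trans s0 su).
    + by rewrite (le_trans s0 su').
    + rewrite (le_lt_trans uu')// gt_min; apply/orP; left.
      by rewrite ltr_pdivrMr// ltr_pMr// ltr1n.
  - move=> k _ Mk; apply: le_trans aL.
    pose g u := eta (M (clamp T u) w).
    apply: (@sum_step_le _ v (fun j => xi j w) (fun u => simple_eval h u w) g) => //.
    + by apply: measurable_sum => i; apply: measurable_funM.
    + apply: measurable_funTS; apply: (measurableT_comp meta).
      apply: continuous_measurable_fun.
      exact: (@continuous_clamp R T T0 (fun u => M u w) (@cM w)).
    + by move=> j u _ vju; rewrite (simple_eval_cell (vt j) w vju).
    + move=> u /andP[vu uv]; rewrite /g clamp_id.
        by apply/etaK/Mk; rewrite -v0 vu.
      by rewrite (le_trans s0) -?v0// (le_trans uv).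
    + apply: le_trans Ih; rewrite le_eqVlt; apply/orP; left; apply/eqP; apply: eq_integral => u.
      by rewrite inE/= in_itv/= => uT; rewrite /g clamp_id.
  - rewrite vN => stay; have Sw := AS w Aw stay.
    rewrite (le_trans (ler_norm _))// (le_trans (V_norm1 _ _))//.
    rewrite -[leLHS]mulr1 ler_wpM2l ?expR_ge0// [X in X + _]indicE mem_set//= lerDl.
    by rewrite indicE.
  (* Multiplication by [th] maps the distances from [e1] to [3 * e1] onto the interval from [pi / 2]
     to [3 pi / 2]. *)
  - move=> /andP[ex1 ex2]; apply: (@le_trans _ _ 0); last by rewrite mulr_ge0// addr_ge0.
    rewrite /V /gated_cos pmulr_rle0 ?expR_gt0//; apply: cos_le0_pihalf.
    rewrite normrM (gtr0_norm th0) -the ler_wpM2l ?(ltW th0)//=.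
    by rewrite -mulrA ler_wpM2l ?(ltW th0)// mulrC.
apply: (le_trans fin); rewrite RintegralD// ?iI// !intI// -mulrDr ler_wpM2l ?expR_ge0// lerD2l.
rewrite -lee_fin fineK ?fin_num_measure// (le_trans (measureU2 P mB0 mB1))//.
by rewrite [gamma]splitr EFinD leeD.
Qed.
End staying.

(** * The process at a stopping time *)

Section stopped_process.
Context (R : realType) (d : measure_display) (Omega : measurableType d).
Context (P : probability Omega R) (Ft : R -> set (set Omega)).
Hypothesis usual : usual_filtration P Ft.
Context (M : R -> Omega -> R) (aM : adapted Ft M) (cM : continuous_paths M).
Context (tau : Omega -> R) (st : stopping_time Ft tau).

Lemma stopping_time_ge t : 0 <= t -> Ft t [set w | t <= tau w].
Proof.
move=> t0; have sF := filtration_sigma_algebra usual t0.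
have FC A : Ft t A -> Ft t (~` A).
  by case: sF => _ + _ => /[apply]; rewrite setTD.
have [h1 h2 h3] := sF.
have -> : [set w | t <= tau w] = ~` (\bigcup_n [set w | tau w <= t - n.+1%:R^-1]).
  apply/seteqP; split=> w /= tw.
    move=> [n _ /=]; apply/negP; rewrite -ltNge (lt_le_trans _ tw)//.
    by rewrite ltrBlDr ltrDl invr_gt0.
  rewrite leNgt; apply/negP => tt; apply: tw.
  have [n ne] : exists n, n.+1%:R^-1 < t - tau w.
    exists (Num.trunc (t - tau w)^-1).
    by rewrite -[ltRHS]invrK ltf_pV2 ?posrE ?invr_gt0 ?subr_gt0// truncnS_gt.
  by exists n => //=; rewrite lerBrDr -lerBrDl ltW.
apply: FC; apply: h3 => n.
have [tn|tn] := leP 0 (t - n.+1%:R^-1).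
  apply: (filtration_nondecreasing usual tn); first by rewrite gerBl invr_ge0.
  by case: st => _; apply.
rewrite (_ : [set w | _] = set0)//; apply/seteqP; split=> // w /= tw.
by case: st => /(_ w) tau0 _; move: (le_lt_trans tw tn); rewrite ltNge tau0.
Qed.

Lemma measurable_stopping_time_lt t : measurable [set w | tau w < t].
Proof.
have [t0|t0] := leP t 0.
  rewrite (_ : [set w | _] = set0)//; apply/seteqP; split=> // w /= tw.
  by case: st => /(_ w) tau0 _; move: (lt_le_trans tw t0); rewrite ltNge tau0.
rewrite (_ : [set w | _] = ~` [set w | t <= tau w]).
  apply: measurableC; apply: (filtration_measurable usual (ltW t0)).
  exact: stopping_time_ge (ltW t0).
by apply/seteqP; split=> w /=; rewrite ltNge => /negP.
Qed.

(** By path continuity this is a limit along discretisations of [tau] from below; these take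
    countably many values, so each approximant is measurable. *)
Lemma measurable_stopped : measurable_fun setT (fun w => M (tau w) w).
Proof.
have tau0 w : 0 <= tau w by case: st.
pose f n w := M ((Num.trunc (n.+1%:R * tau w))%:R / n.+1%:R) w.
apply: (@measurable_fun_cvg _ _ _ setT f).
  move=> n _ B mB; rewrite setTI.
  have -> : f n @^-1` B = \bigcup_k ([set w | k%:R / n.+1%:R <= tau w < k.+1%:R / n.+1%:R] `&`
      M (k%:R / n.+1%:R) @^-1` B).
    apply/seteqP; split=> w /=.
      move=> Bw; exists (Num.trunc (n.+1%:R * tau w)) => //; split=> //=.
      by rewrite ler_pdivrMr// ltr_pdivlMr// mulrC trunc_itv// mulr_ge0.
    move=> [k _ [/= kw]]; rewrite /f; congr (B (M (_%:R / _) w)).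
    by apply/esym/truncn_def; rewrite mulrC -ler_pdivrMr// -ltr_pdivlMr.
  apply: bigcupT_measurable => k; apply: measurableI.
    rewrite (_ : [set w | _] = [set w | tau w < k.+1%:R / n.+1%:R] `\` [set w | tau w < k%:R / n.+1%:R]).
      by apply: measurableD; exact: measurable_stopping_time_lt.
    apply/seteqP; split=> w /=.
      by move=> /andP[kw wk]; split=> //; apply/negP; rewrite -leNgt.
    by move=> [wk /negP]; rewrite -leNgt => ->.
  rewrite -[X in measurable X]setTI; apply: (adapted_measurable usual aM) => //.
move=> w _; apply/cvgrPdist_lt => e e0.
have := @cM w; move=> /subspace_continuousP/(_ (tau w)) /=.
rewrite in_itv/= andbT tau0 => /(_ isT)/cvgrPdist_lt/(_ _ e0).
rewrite near_withinE => /nbhs_ballP[r /= r0 rf].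
exists (Num.trunc r^-1) => // n /= rn; apply: rf; last by rewrite /= in_itv/= andbT divr_ge0.
have nr : n.+1%:R^-1 < r.
  rewrite -[ltRHS]invrK ltf_pV2 ?posrE ?invr_gt0//.
  by rewrite (lt_le_trans (truncnS_gt _))// ler_nat ltnS.
have /andP[h1 h2] : (Num.trunc (n.+1%:R * tau w))%:R <= n.+1%:R * tau w < (Num.trunc (n.+1%:R * tau w)).+1%:R.
  by rewrite trunc_itv// mulr_ge0.
rewrite /ball/= ger0_norm.
  rewrite (le_lt_trans _ nr)// lerBlDl -[X in _ + X]mul1r -mulrDl ler_pdivlMr// mulrC.
  by rewrite natr1 ltW.
by rewrite subr_ge0 ler_pdivrMr// [leRHS]mulrC.
Qed.
End stopped_process.

(** * Decomposition by the first visit on a grid *)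

Section first_visit.
Context (R : realType) (d : measure_display) (Omega : measurableType d).
Context (P : probability Omega R) (Ft : R -> set (set Omega)).
Hypothesis usual : usual_filtration P Ft.

(** The union is split by the first index that occurs: [B n] minus the earlier events is in
    [Ft (t n)], and the hypothesis is applied to each of these disjoint pieces. This is why it must
    hold for all subevents of [B k] in [Ft (t k)]. *)
Lemma first_visit_bound (t : nat -> R) (B : nat -> set Omega) (S : set Omega) (c : R) :
  0 <= t 0%N -> (forall k, t k <= t k.+1) -> (forall k, Ft (t k) (B k)) -> measurable S ->
  (forall k A, Ft (t k) A -> A `<=` B k -> c * fine (P A) <= fine (P (A `&` S))) ->
  forall n, c * fine (P (\big[setU/set0]_(k < n) B k)) <= fine (P S).
Proof.
move=> t0 tnd FB mS cB n.
have tk k : 0 <= t k := le_trans t0 (nondecreasing_step tnd (leq0n k)).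
pose U n := \big[setU/set0]_(k < n) B k.
have FE k A : Ft (t k) A = measurable (A : set (g_sigma_algebraType (Ft (t k)))).
  by rewrite measurable_g_measurableTypeE//; exact: filtration_sigma_algebra usual _ (tk k).
have FU k : Ft (t k) (U k).
  rewrite FE /U; apply: bigsetU_measurable => i _; rewrite -FE.
  by apply: (filtration_nondecreasing usual (tk i) _ (FB i)); apply: nondecreasing_step => //; exact: ltnW.
have mFt k A : Ft (t k) A -> measurable A by exact: (filtration_measurable usual (tk k)).
suff : c * fine (P (U n)) <= fine (P (U n `&` S)).
  move=> /le_trans; apply; rewrite fine_le ?fin_num_measure//; first exact: measurableI (mFt _ _ (FU n)) mS.
  apply: le_measure; rewrite ?inE//; exact: measurableI (mFt _ _ (FU n)) mS.
elim: n => [|n IH]; first by rewrite /U big_ord0 set0I measure0 mulr0.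
have mU := mFt _ _ (FU n); have mB := mFt _ _ (FB n).
have FD : Ft (t n) (B n `\` U n) by rewrite FE; apply: measurableD; rewrite -FE.
have US : U n.+1 = U n `|` (B n `\` U n).
  rewrite /U big_ord_recr/=; apply/seteqP; split=> w.
    by move=> [Uw|Bw]; [left|have [Uw|nUw] := pselect (U n w); [left|right]].
  by move=> [Uw|[Bw _]]; [left|right].
have mD := mFt _ _ FD.
have E1 : fine (P (U n.+1)) = fine (P (U n)) + fine (P (B n `\` U n)).
  rewrite US measureU//; first by rewrite fineD ?fin_num_measure.
  by rewrite setDE setICA setICr setI0.
have E2 : fine (P (U n.+1 `&` S)) = fine (P (U n `&` S)) + fine (P ((B n `\` U n) `&` S)).
  have mUS := measurableI _ _ mU mS; have mDS := measurableI _ _ mD mS.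
  rewrite US setIUl measureU//; first by rewrite fineD ?fin_num_measure.
  by apply/seteqP; split=> // w [[Uw _] [[_ nU] _]].
rewrite E1 E2 mulrDr; apply: lerD => //; exact: (cB n (B n `\` U n) FD (@subDsetl _ _ _)).
Qed.

Context (M : R -> Omega -> R) (aM : adapted Ft M) (cM : continuous_paths M).
Context (tau : Omega -> R) (st : stopping_time Ft tau) (T : R) (T0 : 0 < T).
Hypothesis tauT : forall w, tau w <= T.

(** By continuity a visit to [x] at time [s] is seen, within [dl], at all sufficiently fine grid
    times just before [s]. Approaching from below keeps these times no later than [tau]; continuity
    of [P] along increasing events then gives one level [N]. *)
Lemma dyadic_visit (E : set Omega) (x dl p : R) : measurable E -> 0 < dl ->
  (forall w, E w -> exists s, 0 <= s <= tau w /\ M s w = x) -> (p%:E < P E)%E ->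
  exists N, (p%:E <= P (\big[setU/set0]_(k < (2 ^ N).+1)
     (M (T * k%:R / 2 ^+ N) @^-1` `[(x - dl)%R, (x + dl)%R]
       `&` [set w | (T * k%:R / 2 ^+ N <= tau w)%R])))%E.
Proof.
move=> mE dl0 hit pE.
pose t N k : R := T * k%:R / 2 ^+ N.
have t0 N k : 0 <= t N k by rewrite /t divr_ge0 ?exprn_ge0// mulr_ge0// ltW.
pose B N k := M (t N k) @^-1` `[(x - dl)%R, (x + dl)%R] `&` [set w | t N k <= tau w].
pose G N := \bigcup_(k in `I_(2 ^ N).+1) B N k.
have mB N k : measurable (B N k).
  apply: measurableI.
    rewrite -[X in measurable X]setTI; apply: (adapted_measurable usual aM (t0 N k)) => //.
  exact: (filtration_measurable usual (t0 N k) (stopping_time_ge usual st (t0 N k))).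
have mG N : measurable (G N) by apply: bigcup_measurable => k _; exact: mB.
have ndG : nondecreasing_seq G.
  apply/nondecreasing_seqP => N; apply/subsetPset => w [k /= kN Bw].
  (* The grids are nested: time [k] of level [N] is time [2 k] of level [N + 1]. *)
  exists (2 * k)%N => /=; first by rewrite expnS ltnS leq_mul2l/= -ltnS.
  rewrite /B (_ : t N.+1 (2 * k)%N = t N k)// /t natrM exprS; field.
  by rewrite expf_neq0.
have EG : E `<=` \bigcup_N G N.
  move=> w /hit[s [/andP[s0 sw] Msx]].
  have := @cM w; move=> /subspace_continuousP/(_ s) /=.
  rewrite in_itv/= andbT s0 => /(_ isT)/cvgrPdist_lt/(_ _ dl0).
  rewrite near_withinE => /nbhs_ballP[r /= r0 rf].
  have [N Nr] : exists N, T / 2 ^+ N < r.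
    exists (Num.trunc (T / r)); rewrite ltr_pdivrMr ?exprn_gt0// mulrC -ltr_pdivrMr//.
    rewrite (lt_le_trans (truncnS_gt _))// -natrX ler_nat.
    exact: ltn_expl.
  (* The last grid time not after [s]. *)
  pose k := Num.trunc (s * 2 ^+ N / T).
  have N0 : 0 < 2 ^+ N / T :> R by rewrite divr_gt0 ?exprn_gt0.
  have /andP[k1 k2] : k%:R <= s * 2 ^+ N / T < k.+1%:R.
    by rewrite trunc_itv// -mulrA mulr_ge0// ltW.
  have P2 : 0 < 2 ^+ N :> R by rewrite exprn_gt0.
  have tks : t N k <= s.
    by rewrite /t ler_pdivrMr// mulrC -ler_pdivlMr.
  have stk : s < t N k + T / 2 ^+ N.
    rewrite /t -mulrDl -[X in _ + X]mulr1 -mulrDr natr1.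
    by rewrite ltr_pdivlMr// [ltRHS]mulrC -ltr_pdivrMr.
  exists N => //; exists k => /=.
    rewrite ltnS -(ler_nat R) (le_trans k1)// natrX ler_pdivrMr// mulrC ler_wpM2l ?(ltW P2)//.
    exact: le_trans sw (tauT w).
  split=> /=; last exact: le_trans sw.
  have := rf (t N k); rewrite /= in_itv/= andbT t0 => H.
  have {H} : `|M s w - M (t N k) w| < dl.
    by apply: H => //; rewrite /ball/= ger0_norm ?subr_ge0//; lra.
  by rewrite Msx in_itv/= ltr_norml => /andP[h1 h2]; apply/andP; split; lra.
have : P (G N) @[N --> \oo] --> P (\bigcup_N G N).
  by apply: nondecreasing_cvg_mu => //; exact: bigcup_measurable.
have pU : (p%:E < P (\bigcup_N G N))%E.
  by rewrite (lt_le_trans pE)// le_measure ?inE//; exact: bigcup_measurable.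
move=> cG; apply: contrapT => /forallNP nex.
have : (P (\bigcup_N G N) <= p%:E)%E.
  rewrite -(cvg_lim _ cG)//; apply: lime_le; first by apply/cvg_ex; exists (P (\bigcup_N G N)).
  near=> N; have := nex N; rewrite -(bigcup_mkord _ (B N)) => /negP; rewrite -ltNge => /ltW.
  exact.
by rewrite leNgt pU.
Unshelve. all: by end_near. Qed.
End first_visit.

(** * Lower bound for the probability of a small ball at [tau] *)

Section embedding.
Context (R : realType) (d : measure_display) (Omega : measurableType d).
Context (P : probability Omega R) (Ft : R -> set (set Omega)).
Hypothesis usual : usual_filtration P Ft.
Context (W M : R -> Omega -> R) (BM : brownian_motion P Ft W) (eta : R -> R) (m : R).
Context (sol : sde_solution P Ft eta m W M) (meta : measurable_fun [set: R] eta).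
Context (tau : Omega -> R) (st : stopping_time Ft tau) (T : R) (T0 : 0 < T).
Hypothesis tauT : forall w, tau w <= T.

(** The estimate with [gamma] has constants independent of [gamma], so [gamma = g / E] makes the
    extra term an arbitrary [g]. *)
Lemma staying (s x e1 e2 dl K L rho : R) (A S : set Omega) :
  0 <= s <= T -> Ft s A -> measurable S -> 0 < e1 -> e1 < e2 -> 0 <= dl < e1 ->
  0 <= K -> K ^+ 2 * T < L -> (forall y, `|y - x| <= e2 -> `|eta y| <= K) ->
  (forall w, A w -> `|M s w - x| <= dl) ->
  (forall w, A w -> (forall u, s <= u <= T -> `|M u w - x| <= e2) -> S w) -> 1 < rho ->
  cos (pi / (2 * e1) * dl) * fine (P A) <=
  expR (rho * (pi / (2 * e1)) ^+ 2 / 2 * L) * fine (P (A `&` S)).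
Proof.
move=> sT FA mS e10 e12 dle K0 KL etaK AM AS rho1.
apply/ler_addgt0Pr => g g0; set E := expR _.
have E0 : 0 < E by exact: expR_gt0.
have := staying_gamma usual BM sol meta sT FA mS e10 e12 dle K0 KL etaK AM AS rho1 (divr_gt0 g0 E0).
by rewrite -/E mulrDr [X in _ + X]mulrC divfK ?gt_eqF.
Qed.

(** Visits are recorded within [dl = e1 / 2], whence [theta dl = pi / 4]. The grid level depends on
    [e1], but drops out of the bound because the pieces of the first-visit decomposition add up to
    probability at least [p]. *)
Lemma small_ball_ge (E : set Omega) (x e1 e2 K L rho p : R) : measurable E ->
  (forall w, E w -> exists s : R, 0 <= s <= tau w /\ M s w = x) -> 0 <= p -> (p%:E < P E)%E ->
  0 < e1 -> e1 < e2 -> 0 <= K -> K ^+ 2 * T < L ->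
  (forall y, `|y - x| <= e2 -> `|eta y| <= K) -> 1 < rho ->
  cos (pi / 4) * expR (- (rho * (pi / (2 * e1)) ^+ 2 / 2 * L)) * p <=
  fine (P ((fun w => M (tau w) w) @^-1` `[x - e2, x + e2])).
Proof.
move=> mE hit p0 pE e10 e12 K0 KL etaK rho1.
have aM := sde_adapted sol; have cM := sde_continuous sol.
have dl0 : 0 < e1 / 2 by rewrite divr_gt0.
have [N pN] := dyadic_visit usual aM cM st T0 tauT mE dl0 hit pE.
set S := _ @^-1` `[x - e2, _]; set c := cos _ * _.
have mS : measurable S.
  by rewrite -[S]setTI; apply: (measurable_stopped usual aM cM st).
have c0 : 0 <= c.
  rewrite mulr_ge0 ?expR_ge0// cos_ge0_pihalf//; have := pi_gt0 R; move=> pi0; apply/andP; split; lra.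
set t := fun k : nat => T * k%:R / 2 ^+ N.
have t0 k : 0 <= t k by rewrite /t divr_ge0 ?exprn_ge0// mulr_ge0// ltW.
set B := fun k : nat => M (t k) @^-1` `[x - e1 / 2, x + e1 / 2] `&` [set w | t k <= tau w].
have sig k := filtration_sigma_algebra usual (t0 k).
have FB k : Ft (t k) (B k).
  have FE A : Ft (t k) A = measurable (A : set (g_sigma_algebraType (Ft (t k)))).
    by rewrite measurable_g_measurableTypeE.
  rewrite FE; apply: measurableI; rewrite -FE; first by apply: aM.
  exact: (stopping_time_ge usual st (t0 k)).
have BS k A : Ft (t k) A -> A `<=` B k -> c * fine (P A) <= fine (P (A `&` S)).
  move=> FA AB.
  (* The decomposition asks for every [k]; beyond [T] the event [B k] is empty, since [tau] is at
     most [T]. *)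
  have [tT|Tt] := leP (t k) T; last first.
    rewrite (_ : A = set0) ?measure0 ?mulr0 ?set0I ?measure0//.
    by rewrite -subset0 => w /AB[_ /= /le_trans/(_ (tauT w))]; rewrite leNgt Tt.
  have := @staying (t k) x e1 e2 (e1 / 2) K L rho A S.
  rewrite t0 tT (_ : pi / (2 * e1) * (e1 / 2) = pi / 4); last by field; rewrite gt_eqF.
  move=> H; rewrite /c mulrAC expRN ler_pdivrMr ?expR_gt0// [leRHS]mulrC; apply: H => //.
  - by rewrite (ltW dl0)/=; lra.
  - by move=> w /AB[/= + _]; rewrite in_itv/= ler_distl.
  (* The time [tau] lies between the recorded visit and [T], so the path is still in the window
     then. *)
  - move=> w /AB[_ /= tw] h; rewrite /S/= in_itv/= -ler_distl; apply: h; rewrite tw; exact: tauT.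
have tnd k : t k <= t k.+1.
  by rewrite /t ler_pM2r ?invr_gt0 ?exprn_gt0// ler_pM2l// ler_nat.
apply: le_trans (first_visit_bound usual (t0 0%N) tnd FB mS BS (2 ^ N).+1).
rewrite ler_wpM2l// -lee_fin fineK// fin_num_measure//.
apply: bigsetU_measurable => i _; exact: (filtration_measurable usual (t0 i) (FB i)).
Qed.
End embedding.

(** * What the distribution function says about [M] at [tau] *)

Section distribution.
Context (R : realType) (d : measure_display) (Omega : measurableType d).
Context (P : probability Omega R) (X : Omega -> R) (F : R -> R).
Hypotheses (mX : measurable_fun setT X) (XF : has_distribution_function P X F).

Lemma distribution_function_diff (a b : R) : a <= b ->
  F b - F a = fine (P (X @^-1` `]a, b])).
Proof.
move=> ab.
have ms c : measurable [set w | X w <= c].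
  rewrite (_ : [set w | _] = setT `&` X @^-1` `]-oo, c]); first exact: mX.
  by rewrite setTI; apply/seteqP; split=> w /=; rewrite in_itv.
have -> : X @^-1` `]a, b] = [set w | X w <= b] `\` [set w | X w <= a].
  apply/seteqP; split=> w /=; rewrite in_itv/=.
    by move=> /andP[aX Xb]; split=> //; apply/negP; rewrite -ltNge.
  by move=> [Xb /negP]; rewrite -ltNge => aX; rewrite aX.
rewrite measureD// ?(le_lt_trans (probability_le1 P (ms _))) ?ltry//.
rewrite (_ : _ `&` _ = [set w | X w <= a]); last first.
  by apply/seteqP; split=> w /= => [[]//|Xa]; split=> //; exact: le_trans ab.
rewrite -[LHS]/(fine ((F b)%:E - (F a)%:E)); congr fine.
by congr (_ - _)%E; exact/esym/XF.
Qed.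
End distribution.

Section hitting.
Context (R : realType) (d : measure_display) (Omega : measurableType d).
Context (P : probability Omega R) (Ft : R -> set (set Omega)).
Hypothesis usual : usual_filtration P Ft.
Context (M : R -> Omega -> R) (aM : adapted Ft M) (cM : continuous_paths M).
Context (m : R) (M0 : {ae P, forall w, M 0 w = m}).
Context (tau : Omega -> R) (st : stopping_time Ft tau) (F : R -> R).
Hypothesis XF : has_distribution_function P (fun w => M (tau w) w) F.

(** If [m <= x], the paths ending above [x] are taken, otherwise those ending at or below [x]; both
    have positive probability because [0 < F x < 1]. The intermediate value theorem on [[0, tau]]
    gives the visit, after restriction to paths that start exactly at [m]. Halving the probability
    makes the bound strict. *)
Lemma hitting_event (x : R) : 0 < F x < 1 -> exists (E : set Omega) (p : R),
  [/\ measurable E, 0 < p, (p%:E < P E)%E &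
      forall w, E w -> exists s : R, 0 <= s <= tau w /\ M s w = x].
Proof.
move=> /andP[F0 F1].
have mX := measurable_stopped usual aM cM st.
pose Q : set Omega := [set w | M (tau w) w <= x].
have mQ : measurable Q.
  rewrite (_ : Q = setT `&` (fun w => M (tau w) w) @^-1` `]-oo, x]); first by apply: mX.
  by rewrite setTI; apply/seteqP; split=> w /=; rewrite in_itv.
pose Z := M 0 @^-1` [set m].
have mZ : measurable Z.
  by rewrite -[Z]setTI; apply: (adapted_measurable usual aM (lexx 0)).
have Z0 : P (~` Z) = 0%E.
  by apply/negligibleP; [exact: measurableC|exact: M0].
have PZ A : measurable A -> P (A `&` Z) = P A.
  move=> mA; have mAZ := measurableI _ _ mA mZ; have mAC := measurableI _ _ mA (measurableC mZ).
  rewrite -[in RHS](setUIDK A Z) setDE measureU//; last first.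
    by apply/seteqP; split=> // w [[_ Zw] [_ nZw]].
  transitivity (P (A `&` Z) + 0)%E; first by rewrite adde0.
  congr (_ + _)%E; apply/esym/eqP; rewrite eq_le measure_ge0 andbT -Z0 le_measure ?inE//.
  exact: measurableC.
have [G [mG G0 Gx]] : exists G : set Omega, [/\ measurable G, (0 < P G)%E &
    forall w, G w -> Num.min m (M (tau w) w) <= x <= Num.max m (M (tau w) w)].
  have [mx|xm] := leP m x.
    exists (~` Q); split; first exact: measurableC.
      rewrite probability_setC// XF -EFinB lte_fin; lra.
    move=> w /= /negP; rewrite -ltNge => /ltW xM.
    by rewrite minEle maxEle (le_trans mx xM) mx xM.
  exists Q; split=> //; first by rewrite XF lte_fin.
  by move=> w /= Mx; rewrite minEge maxEge (ltW (le_lt_trans Mx xm)) Mx ltW.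
have fG : P G \is a fin_num by exact: fin_num_measure.
exists (G `&` Z), (fine (P G) / 2); split.
- exact: measurableI.
- by rewrite divr_gt0// fine_gt0// G0 ltey_eq fG.
- rewrite PZ// -[ltRHS]fineK// lte_fin.
  have : 0 < fine (P G) by rewrite fine_gt0// G0 ltey_eq fG.
  move: (fine _) => q; lra.
move=> w [/Gx + Zw] => xw.
have tau0 : 0 <= tau w by case: st.
have c0 : {within `[0, tau w], continuous (fun s => M s w)}.
  apply: continuous_subspaceW (@cM w); apply/subset_itvl => //.
have := IVT tau0 c0; rewrite /= Zw => /(_ _ xw)[s]; rewrite in_itv/= => sw Ms.
by exists s.
Qed.
End hitting.

(** * Choice of constants and the upper semicontinuous envelope *)

Lemma exists_small_factor (R : realFieldType) (a b : R) : 0 <= a -> 0 < b ->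
  exists k : R, 0 < k <= 1 /\ a * k <= b.
Proof.
move=> a0 b0; have a1 : 0 < a + 1 by rewrite ltr_wpDl.
exists (Num.min 1 (b / (a + 1))); split.
  by rewrite lt_min ltr01 divr_gt0//= ge_min lexx.
apply: (@le_trans _ _ ((a + 1) * (b / (a + 1)))); last by rewrite mulrC divfK// gt_eqF.
by rewrite ler_pM// ?ge_min ?lexx ?orbT ?lerDl ?ler01// le_min ler01 divr_ge0// ltW.
Qed.

(** The cube collects one factor from [rho = 1 + h] and two from the square of [e / e1 = 1 + h].
    Half of [delta] goes into [L]; a quarter bounds the cost of raising [u] to [K], another quarter
    that of the cube, through [(1 + h)^3 <= 1 + 7 h]. *)
Lemma rate_constants (R : realFieldType) (u T delta : R) : 0 <= u -> 0 < T -> 0 < delta ->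
  exists K L h : R, [/\ u < K, K ^+ 2 * T < L, 0 < h & (1 + h) ^+ 3 * L <= T * u ^+ 2 + delta].
Proof.
move=> u0 T0 d0; have d4 : 0 < delta / 4 by rewrite divr_gt0.
have a0 : 0 <= T * (2 * u + 1) by rewrite mulr_ge0 ?ltW//; lra.
have [k [/andP[k0 k1] ak]] := exists_small_factor a0 d4.
pose L := T * u ^+ 2 + delta / 2.
have L0 : 0 < L by rewrite /L ltr_wpDl ?divr_gt0// mulr_ge0 ?sqr_ge0// ltW.
have a7 : 0 <= 7 * L by lra.
have [h [/andP[h0 h1] hL]] := exists_small_factor a7 d4.
exists (u + k), L, h; split=> //; first by rewrite ltrDl.
  have kk : T * (k * k) <= T * k by rewrite ler_wpM2l ?(ltW T0)//; nra.
  have -> : (u + k) ^+ 2 * T = T * u ^+ 2 + (T * (2 * u + 1) * k - (T * k - T * (k * k))) by ring.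
  rewrite /L; lra.
have h3 : (1 + h) ^+ 3 <= 1 + 7 * h.
  have : h ^+ 2 <= h by rewrite expr2; nra.
  have : h ^+ 3 <= h by rewrite !exprS expr0 mulr1; nra.
  have -> : (1 + h) ^+ 3 = 1 + 3 * h + 3 * h ^+ 2 + h ^+ 3 by ring.
  lra.
apply: le_trans (ler_wpM2r (ltW L0) h3) _.
have -> : (1 + 7 * h) * L = L + 7 * L * h by ring.
rewrite /L; rewrite /L in hL; lra.
Qed.

Lemma usc_envelope_fin_num (R : realType) (eta : R -> R) (x : R) :
  (forall y, 0 <= eta y) -> locally_bounded eta ->
  exists2 u : R, 0 <= u & usc_envelope eta x = u%:E.
Proof.
move=> eta0 lb.
have := le_usc_envelope eta x.
have : (usc_envelope eta x < +oo)%E.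
  have [C [_ /(_ (C + 1))]] := lb x; rewrite ltrDl ltr01 => /(_ isT) CV.
  apply: (@le_lt_trans _ _ (C + 1)%:E); last exact: ltry.
  apply: (@le_trans _ _ (ereal_sup ((EFin \o eta) @` [set y | `|eta y| <= C + 1]))).
    by apply: ereal_inf_lbound; exists [set y | `|eta y| <= C + 1].
  by apply: ge_ereal_sup => _ [y /= yC <-]; rewrite lee_fin (le_trans (ler_norm _)).
by case: (usc_envelope eta x) => [u| |]// _; rewrite lee_fin => /(le_trans (eta0 x)) u0; exists u.
Qed.

Lemma usc_envelope_lt (R : realType) (eta : R -> R) (x K : R) :
  (usc_envelope eta x < K%:E)%E -> \forall y \near x, eta y < K.
Proof.
move=> /ereal_inf_lt[_ [V Vx <-] supV]; apply: filterS Vx => y Vy.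
by rewrite -lte_fin; apply: le_lt_trans supV; apply: ereal_sup_ubound; exists y.
Qed.

(** * The logarithmic asymptotics *)

Theorem theorem5 (R : realType) (eta : R -> R) (m : R)
  (eta_ge0 : forall x, 0 <= eta x)
  (eta_measurable : measurable_fun [set: R] eta)
  (eta_zeros : forall x, eta x = 0 <-> ~ inv_square_integrable_near eta x)
  (lt_left_m : (left_endpoint eta m < m%:E)%E)
  (lt_m_right : (m%:E < right_endpoint eta m)%E)
  (eta_outside : forall x : R,
    (x%:E < left_endpoint eta m)%E \/ (right_endpoint eta m < x%:E)%E -> eta x = 0)
  (d : measure_display) (Omega : measurableType d) (P : probability Omega R)
  (Ft : R -> set (set Omega)) (W M : R -> Omega -> R)
  (Ft_usual : usual_filtration P Ft)
  (W_brownian : brownian_motion P Ft W)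
  (M_solution : sde_solution P Ft eta m W M)
  (M_absorbed_left : absorbed_at P (left_endpoint eta m) M)
  (M_absorbed_right : absorbed_at P (right_endpoint eta m) M)
  (eta_bounded : locally_bounded eta)
  (F : R -> R) (T : R) (T_gt0 : 0 < T)
  (F_embeddable : embeddable_before P Ft M T F)
  (x : R) (Fx : 0 < F x < 1) :
  (limf_esup (fun e : R => - (e ^+ 2)%:E * lne (F (x + e) - F (x - e))%:E) 0^'+
     <= ((pi ^+ 2 / 8 * T)%R)%:E * usc_envelope eta x ^+ 2)%E.
Proof.
have aM := sde_adapted M_solution; have cM := sde_continuous M_solution.
have [tau [st tauT XF]] := F_embeddable.
have mX := measurable_stopped Ft_usual aM cM st.
have [E [p [mE p0 pE hit]]] := hitting_event Ft_usual aM cM (sde_start M_solution) st XF Fx.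
have [u u0 uE] := usc_envelope_fin_num x eta_ge0 eta_bounded.
rewrite uE -EFin_expe -EFinM; apply/lee_addgt0Pr => g g0; rewrite -EFinD.
set C := pi ^+ 2 / 8; have pi0 := pi_gt0 R.
have C0 : 0 < C by rewrite /C divr_gt0// exprn_gt0.
have g2 : 0 < g / 2 by rewrite divr_gt0.
(* One half of the slack [g] is spent on the rate, after division by [C]; the other half is left for
   the prefactor [c]. *)
have [K [L [h [uK KL h0 hL]]]] := rate_constants u0 T_gt0 (divr_gt0 g2 C0).
have K0 : 0 <= K := ltW (le_lt_trans u0 uK).
have : \forall y \near x, eta y < K by apply: usc_envelope_lt; rewrite uE lte_fin.
move=> /nbhs_ballP[r /= r0 rK].
have c0 : 0 < cos (pi / 4 : R) by rewrite cos_gt0_pihalf//; apply/andP; split; lra.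
set c := cos (pi / 4) * p; have cp : 0 < c by rewrite mulr_gt0.
(* For [0 < e < k <= 1] one has [e^2 <= k], so the term [e^2 ln c] costs at most [g / 2]. *)
have [k [/andP[k0 k1] kc]] := exists_small_factor (normr_ge0 (ln c)) g2.
apply: (@le_trans _ _ (ereal_sup ((fun e : R => - (e ^+ 2)%:E * lne (F (x + e) - F (x - e))%:E)%E
    @` [set e | 0 < e < Num.min k r]))).
  apply: ereal_inf_lbound; exists [set e | 0 < e < Num.min k r] => //.
  have mkr : 0 < Num.min k r by rewrite lt_min k0.
  by near=> e; apply/andP; split; near: e; [exact: nbhs_right_gt|exact: nbhs_right_lt].
apply: ge_ereal_sup=> _ [e ekr <-].
have /and3P[e0 ek er] : [&& 0 < e, e < k & e < r] by rewrite -lt_min.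
have h1 : 0 < 1 + h by rewrite ltr_wpDl.
(* [e2] is put strictly between [e1] and [e], so that the closed ball of radius [e2] fits into the
   half-open interval measured by [F]. *)
set e1 := e / (1 + h); have e10 : 0 < e1 by rewrite divr_gt0.
have e1e : e1 < e by rewrite /e1 ltr_pdivrMr// ltr_pMr// ltrDl.
set e2 := (e1 + e) / 2.
have e12 : e1 < e2 by rewrite /e2; lra.
have e2e : e2 < e by rewrite /e2; lra.
have etaK y : `|y - x| <= e2 -> `|eta y| <= K.
  move=> yx; rewrite ger0_norm//; apply/ltW/rK; rewrite /ball/= distrC.
  by rewrite (le_lt_trans yx)// (lt_trans e2e).
have h11 : 1 < 1 + h by rewrite ltrDl.
have := small_ball_ge Ft_usual W_brownian M_solution eta_measurable st T_gt0 tauT mE hit (ltW p0) pE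
  e10 e12 K0 KL etaK h11.
set D := (_ * p) => Dle.
have : D <= F (x + e) - F (x - e).
  rewrite (distribution_function_diff mX XF); last by lra.
  have mI (I : interval R) : measurable ((fun w => M (tau w) w) @^-1` [set` I]).
    by rewrite -[X in measurable X]setTI; apply: mX.
  apply: (le_trans Dle); rewrite fine_le ?fin_num_measure// le_measure ?inE//.
  by move=> w; rewrite /= !in_itv/= => /andP[a1 a2]; apply/andP; split; lra.
move=> DF.
have D0 : 0 < D by rewrite !mulr_gt0 ?expR_gt0.
have lnD : ln D = ln c - (1 + h) ^+ 3 * L * C / e ^+ 2.
  rewrite /D mulrAC lnM ?posrE ?expR_gt0// expRK /C /e1; congr (_ - _); field.
  by rewrite !gt_eqF.
have DF0 := lt_le_trans D0 DF.
have lnF : ln D <= ln (F (x + e) - F (x - e)) by rewrite ler_ln ?posrE.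
(* The increment of [F] is at least [D > 0], so the logarithm is finite here. *)
rewrite lne_EFin// -EFinN -EFinM lee_fin mulNr.
have ee : 0 < e ^+ 2 by rewrite exprn_gt0.
have := ler_wpM2l (ltW ee) lnF; rewrite lnD mulrBr [X in _ - X]mulrC divfK ?gt_eqF//.
have := ler_wpM2r (ltW C0) hL; rewrite mulrDl divfK ?gt_eqF//.
have : - (e ^+ 2 * ln c) <= g / 2.
  apply: le_trans kc; apply: (le_trans (ler_norm _)).
  rewrite normrN normrM (gtr0_norm ee) mulrC ler_wpM2l//.
  by rewrite expr2; nra.
rewrite -[C * T * _]mulrA [X in _ <= X + g]mulrC.
move: (e ^+ 2 * ln c) (_ * L * C) (T * _ * C) (_ * ln _) => y1 y2 y3 y4; lra.
Unshelve. all: by end_near. Qed.
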